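(* Let $\mathcal X=\{\mathcal X_n\}$ be a prior supported on unit vectors in $\mathbb R^n$ such that the distribution of $\langle x,x'\rangle$, for $x,x'$ drawn independently from $\mathcal X_n$, is symmetric about zero. Suppose that $\mathcal X$ has a rate function $f_{\mathcal X}(t)$ and is locally subgaussian (with some constant). Suppose the limit $F=\lim_{t\to1^-}f_{\mathcal X}(t)$ exists. Then for any $\lambda<2\sqrt F$, it holds for all sufficiently large $d$ that weak detection and weak recovery are impossible for $\mathrm{WT}(d,\lambda,\mathcal X)$.
   Context: Wigner tensor: for integers $d\ge2$, $n\ge1$, $\mathrm{WT}(d)=\mathrm{WT}_n(d)$ is the law of the symmetric tensor $W\in(\mathbb R^n)^{\otimes d}$ obtained by drawing $W'\in\mathbb R^{n^d}$ with i.i.d. $\mathcal N(0,2/n)$ entries and averaging it over all $d!$ permutations of the indices. Spiked model: a prior $\mathcal X=\{\mathcal X_n\}$ is a family of distributions on unit vectors of $\mathbb R^n$; for $\lambda\ge0$ not depending on $n$, $\mathrm{WT}(d,\lambda,\mathcal X)$ is the law of $T=\lambda x^{\otimes d}+W$ with $x\sim\mathcal X_n$ and $W\sim\mathrm{WT}_n(d)$ independent. Rate function: for $x,x'$ drawn independently from $\mathcal X_n$ and $t\in[0,1)$ let $f_{n,\mathcal X}(t)=-\frac1n\log\Pr[\langle x,x'\rangle\ge t]$. If $f_{n,\mathcal X}(t)\ge b_{n,\mathcal X}(t)$ for some sequence of functions $b_{n,\mathcal X}$ converging uniformly on $[0,1)$ to $f_{\mathcal X}$ as $n\to\infty$, then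 $f_{\mathcal X}$ is called a rate function of $\mathcal X$. Locally subgaussian with constant $\sigma^2$: for all $\eta>0$ there exist $t_0>0$ and $C>0$ (which may depend on $\eta$ but not on $n$) such that $\Pr_{x,x'\sim\mathcal X_n}[\langle x,x'\rangle\ge t]\le C\exp\left(-\frac{nt^2}{2\sigma^2+\eta}\right)$ for all $t\in[0,t_0]$. Weak detection: given a single sample from either $\mathrm{WT}(d,\lambda,\mathcal X)$ or $\mathrm{WT}(d)$, each chosen with probability $1/2$, decide which one with success probability at least $\frac12+\varepsilon$ as $n\to\infty$, for some $\varepsilon>0$ not depending on $n$. Weak recovery: given a sample $T$ from $\mathrm{WT}(d,\lambda,\mathcal X)$, output a unit vector $\hat x=\hat x(T)$ with $\mathbb E[\langle x,\hat x\rangle^d]\ge\varepsilon$ as $n\to\infty$, for some $\varepsilon>0$ not depending on $n$. There is no computational restriction. *)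

(* Defs.v *)
From HB Require Import structures.
From mathcomp Require Import all_boot all_order all_algebra perm.
From mathcomp Require Import all_classical all_reals all_analysis measurable_realfun.

Set Implicit Arguments.
Unset Strict Implicit.
Unset Printing Implicit Defensive.

Import Order.TTheory GRing.Theory Num.Theory.
Import numFieldNormedType.Exports.

Local Open Scope classical_set_scope.
Local Open Scope ring_scope.

Section Vectors.
Context {R : realType}.

(* Vectors of R^n are n-tuples: tuples carry the product (Borel) sigma-algebra. *)
Definition inner n (x y : n.-tuple R) : R :=
  \sum_(i < n) tnth x i * tnth y i.

Definition unit_vector n (x : n.-tuple R) : Prop := inner x x = 1.

End Vectors.

Notation multi_index n d := {ffun 'I_d -> 'I_n}.

(* (R^n)^{\otimes d} is R^(n^d), the coordinates being enumerated by the
   multi-indices (i_0, ..., i_(d-1)). *)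
Notation tensor R n d := (#|{: multi_index n d}|.-tuple R).

Section Tensors.
Context {R : realType}.

Definition mk_tensor n d (F : multi_index n d -> R) : tensor R n d :=
  [tuple F (enum_val k) | k < #|{: multi_index n d}|].

Definition entry n d (T : tensor R n d) (i : multi_index n d) : R :=
  tnth T (enum_rank i).

Lemma entry_mk_tensor n d (F : multi_index n d -> R) i :
  entry (mk_tensor F) i = F i.
Proof. by rewrite /entry tnth_mktuple enum_rankK. Qed.

Definition tensor_pow n d (x : n.-tuple R) : tensor R n d :=
  mk_tensor (fun i => \prod_(k < d) tnth x (i k)).

Definition symmetrize n d (T : tensor R n d) : tensor R n d :=
  mk_tensor (fun i => d`!%:R^-1 * \sum_(s : 'S_d) entry T [ffun k => i (s k)]).

Definition spike n d (lambda : R) (p : n.-tuple R * tensor R n d) :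
    tensor R n d :=
  mk_tensor (fun i => lambda * entry (tensor_pow d p.1) i + entry p.2 i).

Lemma measurable_mk_tensor d0 (T : measurableType d0) n d
    (F : T -> multi_index n d -> R) :
  (forall i, measurable_fun [set: T] (F ^~ i)) ->
  measurable_fun [set: T] (fun t => mk_tensor (F t)).
Proof.
move=> mF; apply/measurable_fun_tnthP => k.
rewrite (_ : _ \o _ = F ^~ (enum_val k)); first exact: mF.
by apply/funext => t /=; rewrite tnth_mktuple.
Qed.

Lemma measurable_symmetrize n d :
  measurable_fun [set: tensor R n d] (@symmetrize n d).
Proof.
apply: measurable_mk_tensor => i; apply: measurable_funM => //.
by apply: measurable_sum => s; exact: measurable_tnth.
Qed.

Lemma measurable_spike n d (lambda : R) :
  measurable_fun [set: n.-tuple R * tensor R n d] (@spike n d lambda).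
Proof.
apply: measurable_mk_tensor => i; apply: measurable_funD; last first.
  apply: (measurableT_comp (measurable_tnth _)); exact: measurable_snd.
apply: measurable_funM => //.
rewrite (_ : (fun _ => _) = fun p => \prod_(k < d) tnth p.1 (i k)); last first.
  by apply/funext => p; rewrite entry_mk_tensor.
apply: measurable_prod => k _.
apply: (measurableT_comp (measurable_tnth _)); exact: measurable_fst.
Qed.

HB.instance Definition _ n d := isMeasurableFun.Build _ _ _ _
  (@symmetrize n d) (@measurable_symmetrize n d).

HB.instance Definition _ n d lambda := isMeasurableFun.Build _ _ _ _
  (@spike n d lambda) (@measurable_spike n d lambda).

End Tensors.

Section IID.
Context d (T : measurableType d) {R : realType}.

Definition tuple_cons n (p : T * n.-tuple T) : n.+1.-tuple T :=
  [tuple of p.1 :: p.2].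

Lemma measurable_tuple_cons n :
  measurable_fun [set: T * n.-tuple T] (@tuple_cons n).
Proof. by apply: measurable_cons. Qed.

HB.instance Definition _ n := isMeasurableFun.Build _ _ _ _
  (@tuple_cons n) (@measurable_tuple_cons n).

(* Law of n i.i.d. draws from P, i.e. the n-fold product measure. *)
Fixpoint iid (P : probability T R) n : probability (n.-tuple T) R :=
  if n is m.+1 then distribution (P \x iid P m)%E (@tuple_cons m)
  else \d_[tuple].

Lemma iid_box (P : probability T R) n (A : 'I_n -> set T) :
  (forall i, measurable (A i)) ->
  iid P n [set x | forall i, A i (tnth x i)] = (\prod_(i < n) P (A i))%E.
Proof.
elim: n A => [|n IH] A mA.
  by rewrite big_ord0 /= diracE mem_set// => -[].
rewrite big_ord_recl -IH// -product_measure1E//; last first.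
  rewrite (_ : mkset _ = \bigcap_(i in [set: 'I_n])
      ((@tnth _ T ^~ i) @^-1` A (lift ord0 i))).
    apply: fin_bigcap_measurable => // i _.
    by rewrite -[X in measurable X]setTI; exact: measurable_tnth.
  by apply/seteqP; split=> x /= h i; [move=> _; exact: h|exact: (h i I)].
rewrite /= /distribution /pushforward; congr (_ _).
apply/seteqP; split=> [[x y]/= h|[x y]/= [h0 h] i].
  by split=> [|i]; [have := h ord0|have := h (lift ord0 i); rewrite tnthS].
by case: (unliftP ord0 i) => [j|] ->; rewrite ?tnthS.
Qed.

End IID.

Section Gaussian.
Context {R : realType}.

(* N(m, v) with v the variance (normal_prob takes the standard deviation), as a
   measure on R with its canonical Borel structure (normal_prob lives on the
   copy measurableTypeR R). *)
Definition gaussian_measure (m v : R) : set R -> \bar R :=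
  normal_prob m (Num.sqrt v).

Let gaussian0 m v : gaussian_measure m v set0 = 0%E.
Proof. exact: (@measure0 _ _ _ (normal_prob m (Num.sqrt v))). Qed.

Let gaussian_ge0 m v A : (0 <= gaussian_measure m v A)%E.
Proof. exact: (@measure_ge0 _ _ _ (normal_prob m (Num.sqrt v))). Qed.

Let gaussian_sigma_additive m v : semi_sigma_additive (gaussian_measure m v).
Proof.
exact: (@measure_semi_sigma_additive _ _ _ (normal_prob m (Num.sqrt v))).
Qed.

HB.instance Definition _ m v := isMeasure.Build _ _ _ (gaussian_measure m v)
  (gaussian0 m v) (gaussian_ge0 m v) (@gaussian_sigma_additive m v).

Let gaussian_setT m v : gaussian_measure m v [set: R] = 1%E.
Proof. exact: (@probability_setT _ _ _ (normal_prob m (Num.sqrt v))). Qed.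

HB.instance Definition _ m v := @Measure_isProbability.Build _ _ R
  (gaussian_measure m v) (gaussian_setT m v).

Definition gaussian (m v : R) : probability R R := gaussian_measure m v.

End Gaussian.

Section Model.
Context {R : realType}.

Definition WT n d : probability (tensor R n d) R :=
  distribution
    (iid (gaussian 0 (2 / n%:R))
         #|{: multi_index n d}|)
    (@symmetrize R n d).

(* Only the laws X n with n > 0 matter: R^0 has no unit vector. *)
Definition on_unit_vectors (X : forall n, probability (n.-tuple R) R) : Prop :=
  forall n, (0 < n)%N -> X n [set x | unit_vector x] = 1%E.

Definition spikedWT (X : forall n, probability (n.-tuple R) R) n d
    (lambda : R) : probability (tensor R n d) R :=
  distribution (X n \x WT n d)%E (@spike R n d lambda).

Definition overlap_symmetric (X : forall n, probability (n.-tuple R) R) : Prop :=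
  forall n, (0 < n)%N -> forall B : set R, measurable B ->
    (X n \x X n)%E [set p | B (inner p.1 p.2)] =
    (X n \x X n)%E [set p | B (- inner p.1 p.2)].

Definition overlap_tail (X : forall n, probability (n.-tuple R) R) n (t : R) :
    \bar R :=
  (X n \x X n)%E [set p | t <= inner p.1 p.2].

(* Takes the value +oo where the tail probability vanishes (lne 0 = -oo). *)
Definition finite_rate (X : forall n, probability (n.-tuple R) R) n (t : R) :
    \bar R :=
  (- ((n%:R^-1)%:E * lne (overlap_tail X n t)))%E.

Definition rate_function (X : forall n, probability (n.-tuple R) R)
    (f : R -> R) : Prop :=
  exists b : nat -> R -> R,
    (forall n t, (0 < n)%N -> 0 <= t < 1 ->
       ((b n t)%:E <= finite_rate X n t)%E) /\
    {uniform `[0, 1[%classic, b @ \oo --> f}.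

Definition locally_subgaussian (X : forall n, probability (n.-tuple R) R)
    (sigma2 : R) : Prop :=
  forall eta : R, 0 < eta -> exists t0 C : R, [/\ 0 < t0, 0 < C &
    forall n t, (0 < n)%N -> 0 <= t <= t0 ->
      (overlap_tail X n t <=
        (C * expR (- (n%:R * t ^+ 2 / (2 * sigma2 + eta))))%:E)%E].

(* The test answers true for "spiked" and false for "unspiked". *)
Definition success_probability (X : forall n, probability (n.-tuple R) R) n d
    (lambda : R) (phi : tensor R n d -> bool) : \bar R :=
  ((2^-1)%:E * spikedWT X n d lambda [set T | phi T = true] +
   (2^-1)%:E * WT n d [set T | phi T = false])%E.

Definition weak_detection (X : forall n, probability (n.-tuple R) R) d
    (lambda : R) : Prop :=
  exists (eps : R) (phi : forall n, {mfun tensor R n d >-> bool}), 0 < eps /\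
    \forall n \near \oo,
      ((2^-1 + eps)%:E <= success_probability X lambda (phi n))%E.

Definition weak_recovery (X : forall n, probability (n.-tuple R) R) d
    (lambda : R) : Prop :=
  exists (eps : R) (xhat : forall n, {mfun tensor R n d >-> n.-tuple R}),
    [/\ 0 < eps,
        forall n T, (0 < n)%N -> unit_vector (xhat n T) &
        \forall n \near \oo, (eps%:E <=
          'E_(X n \x WT n d)[fun p => (inner p.1 (xhat n (spike lambda p)) ^+ d)%R])%E].

End Model.

(* Main.v *)
Require Import Defs.
From HB Require Import structures.
From mathcomp Require Import all_boot all_order all_algebra perm.
From mathcomp Require Import all_classical all_reals all_analysis measurable_realfun.
From mathcomp Require Import ring lra.
Import Order.TTheory GRing.Theory Num.Theory.
Import numFieldNormedType.Exports.
Local Open Scope classical_set_scope.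
Local Open Scope ring_scope.

(* Adding the spike before or after symmetrizing gives the same law, so one may
   work with the unsymmetrized noise W', where by Gaussian change of measure the
   likelihood ratio of the spike x is
   exp ((lambda <x^d, W'> - lambda^2 / 2) / v), v = 2 / n.
   The plain second moment only reaches lambda^2 / 2 < F. It is therefore truncated to
   the event <x^d, W'> <= lambda + delta, which is typical under the planted law.
   For two unit spikes with r = <x, x'>^d the truncated second moment is at most
   exp (n lambda^2 r / 2), and also at most exp (n (lambda^2 / 4 + O(delta))).
   When |<x, x'>| >= t1 close to 1, the second bound is beaten by the tail
   exp (- n f(t1)); when |<x, x'>| <= t1, the first bound is harmless for large d, since
   n |<x, x'>|^d is then dominated by the subgaussian exponent k n <x, x'>^2.  Hence the
   truncated chi-square distance tends to 0, which forbids weak detection, and so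
   does the same second moment weighted by <x, x'>^d, which by Cauchy-Schwarz bounds
   the correlation <x, xhat>^d of any estimator. *)

Set Implicit Arguments.
Unset Strict Implicit.
Unset Printing Implicit Defensive.

(** * Gaussian change of measure *)

Section Gaussian_shift.
Context {R : realType}.
Local Open Scope ereal_scope.
Local Notation mu := (@lebesgue_measure R).

(** The image of Lebesgue measure under a translation gives half-open intervals their length, so by
    uniqueness it is Lebesgue measure again. *)
Lemma ge0_integral_shift (h : R) (g : R -> \bar R) :
  measurable_fun [set: R] g -> (forall x, 0 <= g x) ->
  \int[mu]_x g (h + x)%R = \int[mu]_x g x.
Proof.
move=> mg g0.
have mh : measurable_fun [set: measurableTypeR R] (fun x : R => (h + x)%R : measurableTypeR R).
  exact: measurable_funD.
transitivity (\int[pushforward mu ((fun x => h + x)%R : _ -> measurableTypeR R)]_x g x).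
  by rewrite ge0_integral_pushforward.
apply: eq_measure_integral => /= A mA _.
apply/esym/lebesgue_measure_unique => //= _ [[a b]] _ <-.
rewrite /pushforward/= (_ : _ @^-1` _ = `]a - h, b - h]%classic%R); last first.
  by apply/seteqP; split=> x /=; rewrite !in_itv/= => /andP[? ?]; apply/andP; split; lra.
rewrite !lebesgue_measure_itv/= !lte_fin ltrD2r.
by case: ifPn => // _; rewrite -!EFinD; congr EFin; ring.
Qed.

Lemma ge0_integral_gaussian (v : R) (g : R -> \bar R) :
  measurable_fun [set: R] g -> (forall x, 0 <= g x) ->
  \int[gaussian 0 v]_x g x = \int[mu]_x (g x * (normal_pdf 0 (Num.sqrt v) x)%:E).
Proof.
move=> mg g0.
set s := Num.sqrt v.
have dom := @normal_prob_dominates R 0%R s.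
have mid : measurable_fun setT (idfun : measurableTypeR R -> R).
  by move=> _ A mA; rewrite setTI.
transitivity (\int[normal_prob 0%R s]_x g x).
  (* [normal_prob] lives on the copy [measurableTypeR R] of the line; the identity map pushes it
     forward to the Borel structure of [R]. *)
  transitivity (\int[pushforward (normal_prob 0%R s)
      (idfun : measurableTypeR R -> R)]_x g x).
    exact: eq_measure_integral.
  by rewrite ge0_integral_pushforward.
rewrite -(Radon_Nikodym_SigmaFinite.change_of_variables dom)//.
apply: ae_eq_integral => //.
- apply: emeasurable_funM => //.
  exact: measurable_int (Radon_Nikodym_SigmaFinite.f_integrable dom).
- apply: emeasurable_funM => //; apply/measurable_EFinP; exact: measurable_normal_pdf.
(* The abstract Radon-Nikodym derivative is determined only up to a null set; it agrees almost
   everywhere with the normal density because both have the same integral over every measurable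
   set. *)
suff : ae_eq mu [set: R] (Radon_Nikodym_SigmaFinite.f (normal_prob 0%R s) mu)
    (fun x => (normal_pdf 0 s x)%:E).
  by apply: filterS => x /= + _ => -> //.
apply: integral_ae_eq => //.
- exact: Radon_Nikodym_SigmaFinite.f_integrable dom.
- by apply/measurable_EFinP; exact: measurable_normal_pdf.
by move=> E _ mE; rewrite -(Radon_Nikodym_SigmaFinite.f_integral dom).
Qed.

Lemma normal_pdf_shift (v h x : R) : (0 < v)%R ->
  (normal_pdf 0 (Num.sqrt v) x =
   expR (h * (h + x) / v - h ^+ 2 / (2 * v)) * normal_pdf 0 (Num.sqrt v) (h + x))%R.
Proof.
move=> v0; rewrite normal_pdfE ?gt_eqF ?sqrtr_gt0//= mulrCA; congr *%R.
rewrite /normal_fun -expRD !subr0 sqr_sqrtr ?ltW//; congr expR.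
by field; rewrite gt_eqF.
Qed.

(** One-dimensional Cameron-Martin formula: complete the square in the density, then use translation
    invariance of Lebesgue measure. *)
Lemma ge0_integral_gaussian_shift (v h : R) (g : R -> \bar R) : (0 < v)%R ->
  measurable_fun [set: R] g -> (forall x, 0 <= g x) ->
  \int[gaussian 0 v]_x g (h + x)%R =
  \int[gaussian 0 v]_x (g x * (expR (h * x / v - h ^+ 2 / (2 * v)))%:E).
Proof.
move=> v0 mg g0.
have mh : measurable_fun [set: R] (fun x : R => (h + x)%R) by exact: measurable_funD.
have mE : measurable_fun [set: R] (fun x : R => expR (h * x / v - h ^+ 2 / (2 * v))).
  apply: measurableT_comp => //; apply: measurable_funB => //.
  by apply: measurable_funM => //; exact: measurable_funM.
rewrite !ge0_integral_gaussian//; first last.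
- exact: measurableT_comp.
- by move=> x; rewrite mule_ge0// lee_fin expR_ge0.
- by apply: emeasurable_funM => //; exact/measurable_EFinP.
rewrite -[RHS](ge0_integral_shift h).
- apply: eq_integral => x _; rewrite -muleA -EFinM.
  by congr (_ * _%:E); exact: normal_pdf_shift.
- apply: emeasurable_funM; first apply: emeasurable_funM => //; apply/measurable_EFinP => //.
  exact: measurable_normal_pdf.
- by move=> x; rewrite !mule_ge0// lee_fin ?expR_ge0 ?normal_pdf_ge0.
Qed.

End Gaussian_shift.

(** * Scalar products and translations of vectors *)

Section Tuples.
Context {R : realType}.

Definition shift_tuple n (h w : n.-tuple R) : n.-tuple R :=
  [tuple tnth h i + tnth w i | i < n].

Lemma innerC n (x y : n.-tuple R) : inner x y = inner y x.
Proof. by apply: eq_bigr => i _; rewrite mulrC. Qed.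

Lemma measurable_inner n :
  measurable_fun [set: n.-tuple R * n.-tuple R] (fun p => inner p.1 p.2).
Proof.
apply: measurable_sum => i; apply: measurable_funM.
  by apply: (measurableT_comp (measurable_tnth _)); exact: measurable_fst.
by apply: (measurableT_comp (measurable_tnth _)); exact: measurable_snd.
Qed.

Lemma measurable_innerr n (h : n.-tuple R) : measurable_fun [set: n.-tuple R] (inner h).
Proof. exact: measurableT_comp (@measurable_inner n) (measurable_pair1 h). Qed.

Lemma measurable_innerxx n : measurable_fun [set: n.-tuple R] (fun x => inner x x).
Proof.
apply: (measurableT_comp (@measurable_inner n) (g := fun x => (x, x))).
exact: measurable_fun_pair.
Qed.

Lemma measurable_shift_tuple n (h : n.-tuple R) :
  measurable_fun [set: n.-tuple R] (shift_tuple h).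
Proof.
apply/measurable_fun_tnthP => i.
rewrite (_ : _ \o _ = fun w => tnth h i + tnth w i); last first.
  by apply/funext => w /=; rewrite tnth_mktuple.
by apply: measurable_funD => //; exact: measurable_tnth.
Qed.

Lemma shift_tuple_cons n (a x : R) (h w : n.-tuple R) :
  shift_tuple (tuple_cons (a, h)) (tuple_cons (x, w)) =
  tuple_cons (a + x, shift_tuple h w).
Proof.
apply: eq_from_tnth => i; rewrite tnth_mktuple.
by case: (unliftP ord0 i) => [j|] ->; rewrite ?tnthS ?tnth_mktuple.
Qed.

Lemma inner_cons n (a x : R) (h w : n.-tuple R) :
  inner (tuple_cons (a, h)) (tuple_cons (x, w)) = a * x + inner h w.
Proof.
rewrite /inner big_ord_recl/=; congr (_ + _).
by apply: eq_bigr => i _; rewrite !tnthS.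
Qed.

Lemma tuple_consP n (h : n.+1.-tuple R) : exists p, h = tuple_cons p.
Proof. by case/tupleP: h => a h; exists (a, h); apply/val_inj. Qed.

End Tuples.

(** * Change of measure for Gaussian vectors *)

Section iid_gaussian.
Context {R : realType} (v : R) (v0 : (0 < v)%R).
Local Open Scope ereal_scope.

(** The density of N(h, v I) with respect to N(0, v I). *)
Definition tilt n (h w : n.-tuple R) : R :=
  expR (inner h w / v - inner h h / (2 * v)).

Lemma measurable_tilt n (h : n.-tuple R) :
  measurable_fun [set: n.-tuple R] (tilt h).
Proof.
apply: measurableT_comp => //; apply: measurable_funB => //.
by apply: measurable_funM => //; exact: measurable_innerr.
Qed.

Lemma tilt_ge0 n (h w : n.-tuple R) : 0 <= (tilt h w)%:E.
Proof. by rewrite lee_fin expR_ge0. Qed.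

(** Induction on [n]: Tonelli isolates the first coordinate, the induction hypothesis shifts the
    others, the one-dimensional formula shifts the first, and the two densities multiply to the full
    one. *)
Lemma ge0_integral_iid_shift n (h : n.-tuple R) (g : n.-tuple R -> \bar R) :
  measurable_fun [set: n.-tuple R] g -> (forall w, 0 <= g w) ->
  \int[iid (gaussian 0 v) n]_w g (shift_tuple h w) =
  \int[iid (gaussian 0 v) n]_w (g w * (tilt h w)%:E).
Proof.
elim: n h g => [|n IH] h g mg g0.
  rewrite !integral_dirac//=.
  - rewrite !diracT !mul1e (_ : shift_tuple _ _ = [tuple]); last exact: tuple0.
    by rewrite /tilt /inner !big_ord0 !mul0r subrr expR0 mule1.
  - apply: emeasurable_funM => //; apply/measurable_EFinP; exact: measurable_tilt.
  - by apply: measurableT_comp mg _; exact: measurable_shift_tuple.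
case: (tuple_consP h) => -[a {}h] ->.
have mg' : measurable_fun setT (fun w => g w * (tilt (tuple_cons (a, h)) w)%:E).
  by apply: emeasurable_funM => //; apply/measurable_EFinP; exact: measurable_tilt.
have mgs : measurable_fun setT (fun w => g (shift_tuple (tuple_cons (a, h)) w)).
  by apply: measurableT_comp mg _; exact: measurable_shift_tuple.
have mgc : measurable_fun setT (g \o @tuple_cons _ _ n).
  exact: measurableT_comp mg (@measurable_tuple_cons _ _ n).
have mgx x : measurable_fun setT (fun w => g (tuple_cons (x, w))).
  by apply: measurableT_comp mgc _; exact: measurable_pair1.
rewrite /= !ge0_integral_distribution//; last first.
  by move=> w; rewrite mule_ge0// tilt_ge0.
rewrite !fubini_tonelli1//; first last.
- by move=> p /=; exact: g0.
- exact: measurableT_comp mgs (@measurable_tuple_cons _ _ n).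
- by move=> p /=; rewrite mule_ge0// tilt_ge0.
- exact: measurableT_comp mg' (@measurable_tuple_cons _ _ n).
rewrite /fubini_F/=.
under eq_integral => x _ do under eq_integral => w _ do rewrite shift_tuple_cons.
under eq_integral => x _ do rewrite (IH h (fun w => g (tuple_cons (a + x, w)%R)))//.
have mG : measurable_fun [set: R * n.-tuple R]
    (fun p => g (tuple_cons p) * (tilt h p.2)%:E).
  apply: emeasurable_funM => //; apply/measurable_EFinP.
  by apply: measurableT_comp; [exact: measurable_tilt|exact: measurable_snd].
rewrite (ge0_integral_gaussian_shift a v0
    (g := fun x => \int[iid (gaussian 0 v) n]_w (g (tuple_cons (x, w)) * (tilt h w)%:E)))//.
- apply: eq_integral => x _; rewrite -ge0_integralZr//.
  + apply: eq_integral => w _; rewrite -muleA -EFinM; congr (_ * _%:E).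
    rewrite /tilt -expRD !inner_cons; congr expR.
    by field; rewrite gt_eqF.
  + apply: emeasurable_funM; first exact: mgx.
    by apply/measurable_EFinP; exact: measurable_tilt.
  + by move=> w _; rewrite mule_ge0// tilt_ge0.
- apply: (measurable_fun_fubini_tonelli_F
    (fun p => g (tuple_cons p) * (tilt h p.2)%:E)) => //.
  by move=> p; rewrite mule_ge0// tilt_ge0.
- by move=> x; apply: integral_ge0 => w _; rewrite mule_ge0// tilt_ge0.
Qed.

Lemma integral_tilt n (h : n.-tuple R) :
  \int[iid (gaussian 0 v) n]_w (tilt h w)%:E = 1.
Proof.
have := @ge0_integral_iid_shift n h (cst 1).
under [in X in _ -> _ -> _ = X]eq_integral do rewrite mul1e.
by move=> <-//; rewrite integral_cst// mul1e; exact: probability_setT.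
Qed.

(** The tilt has total mass 1, and its normalizing factor does not depend on [w]. *)
Lemma iid_gaussian_mgf n (h : n.-tuple R) :
  \int[iid (gaussian 0 v) n]_w (expR (inner h w / v))%:E =
  (expR (inner h h / (2 * v)))%:E.
Proof.
rewrite -[RHS]mul1e -(integral_tilt h) -ge0_integralZr//.
- by apply: eq_integral => w _; rewrite -EFinM -expRD subrK.
- by apply/measurable_EFinP; exact: measurable_tilt.
- by move=> w _; exact: tilt_ge0.
Qed.

End iid_gaussian.

(** * Integrals of bounded functions *)

Section bounded_measurable.
Context {R : realType}.

(** Truncation makes all integrands of the second moment computation bounded. This class is closed
    under algebraic operations, composition and partial integration, so integrability and Fubini's
    theorem come for free there. *)
Definition bounded_measurable d (T : measurableType d) (f : T -> R) : Prop :=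
  measurable_fun setT f /\ exists B, forall x, `|f x| <= B.

Section closure.
Context d (T : measurableType d).
Implicit Types f g : T -> R.

Lemma bm_cst (r : R) : bounded_measurable (fun _ : T => r).
Proof. by split=> //; exists `|r|. Qed.

Lemma bmD f g : bounded_measurable f -> bounded_measurable g ->
  bounded_measurable (fun x => f x + g x).
Proof.
move=> [mf [A fA]] [mg [B gB]]; split; first exact: measurable_funD.
by exists (A + B) => x; apply: le_trans (ler_normD _ _) _; exact: lerD.
Qed.

Lemma bmM f g : bounded_measurable f -> bounded_measurable g ->
  bounded_measurable (fun x => f x * g x).
Proof.
move=> [mf [A fA]] [mg [B gB]]; split; first exact: measurable_funM.
by exists (A * B) => x; rewrite normrM; exact: ler_pM.
Qed.

Lemma bmZ (r : R) f : bounded_measurable f -> bounded_measurable (fun x => r * f x).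
Proof. by move=> bf; apply: bmM => //; exact: bm_cst. Qed.

Lemma bmB f g : bounded_measurable f -> bounded_measurable g ->
  bounded_measurable (fun x => f x - g x).
Proof.
move=> [mf [A fA]] [mg [B gB]]; split; first exact: measurable_funB.
by exists (A + B) => x; apply: le_trans (ler_normB _ _) _; exact: lerD.
Qed.

Lemma bm_sum I (r : seq I) (f : I -> T -> R) :
  (forall i, bounded_measurable (f i)) ->
  bounded_measurable (fun x => \sum_(i <- r) f i x).
Proof.
move=> bf; split; first by apply: measurable_sum => i; have [] := bf i.
elim: r => [|i r [B IH]]; first by exists 0 => x; rewrite big_nil normr0.
have [_ [A fA]] := bf i; exists (A + B) => x; rewrite big_cons.
by apply: le_trans (ler_normD _ _) _; exact: lerD.
Qed.

Lemma bm_comp d' (T' : measurableType d') (h : T' -> T) f :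
  measurable_fun setT h -> bounded_measurable f -> bounded_measurable (f \o h).
Proof.
by move=> mh [mf [B fB]]; split; [exact: measurableT_comp|exists B => x; exact: fB].
Qed.

Lemma bm_integrable (P : probability T R) f :
  bounded_measurable f -> P.-integrable setT (EFin \o f).
Proof.
move=> [mf [B fB]]; apply: measurable_bounded_integrable => //.
  by rewrite (le_lt_trans (probability_le1 P measurableT)) ?ltry.
exists B; split; first exact: num_real.
by move=> r Br x _ /=; exact: le_trans (fB x) (ltW Br).
Qed.

End closure.

Section Rintegral_probability.
Context d (T : measurableType d) (P : probability T R).
Implicit Types f g : T -> R.

Lemma RintegralP_cst (r : R) : \int[P]_x r = r.
Proof.
rewrite Rintegral_cst// -[RHS]mulr1; congr (_ * _).
by rewrite -[RHS]/(fine 1%E); congr fine; exact: probability_setT.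
Qed.

Lemma bm_RintegralD f g : bounded_measurable f -> bounded_measurable g ->
  \int[P]_x (f x + g x) = \int[P]_x f x + \int[P]_x g x.
Proof. by move=> bf bg; rewrite RintegralD//; exact: bm_integrable. Qed.

Lemma bm_RintegralB f g : bounded_measurable f -> bounded_measurable g ->
  \int[P]_x (f x - g x) = \int[P]_x f x - \int[P]_x g x.
Proof. by move=> bf bg; rewrite RintegralB//; exact: bm_integrable. Qed.

Lemma bm_RintegralZ (r : R) f : bounded_measurable f ->
  \int[P]_x (r * f x) = r * \int[P]_x f x.
Proof. by move=> bf; rewrite RintegralZl//; exact: bm_integrable. Qed.

Lemma bm_Rintegral_sum I (r : seq I) (f : I -> T -> R) :
  (forall i, bounded_measurable (f i)) ->
  \int[P]_x (\sum_(i <- r) f i x) = \sum_(i <- r) \int[P]_x f i x.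
Proof.
move=> bf; elim: r => [|i r IH].
  by under eq_Rintegral do rewrite big_nil; rewrite RintegralP_cst big_nil.
under eq_Rintegral do rewrite big_cons.
by rewrite bm_RintegralD ?IH ?big_cons//; exact: bm_sum.
Qed.

Lemma bm_le_Rintegral f g : bounded_measurable f -> bounded_measurable g ->
  (forall x, f x <= g x) -> \int[P]_x f x <= \int[P]_x g x.
Proof. by move=> bf bg fg; apply: le_Rintegral => //; exact: bm_integrable. Qed.

Lemma EFin_bm_Rintegral f : bounded_measurable f ->
  (\int[P]_x f x)%:E = (\int[P]_x (f x)%:E)%E.
Proof.
by move=> bf; rewrite fineK//; apply: integrable_fin_num => //; exact: bm_integrable.
Qed.

End Rintegral_probability.

Section Fubini.
Context d1 d2 (T1 : measurableType d1) (T2 : measurableType d2).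
Variables (P1 : probability T1 R) (P2 : probability T2 R).
Variables (f : T1 * T2 -> R) (bf : bounded_measurable f).

Lemma bm_pair1 x : bounded_measurable (fun y => f (x, y)).
Proof. exact: (bm_comp (measurable_pair1 x) bf). Qed.

Lemma bm_pair2 y : bounded_measurable (fun x => f (x, y)).
Proof. exact: (bm_comp (measurable_pair2 y) bf). Qed.

Let intf : (P1 \x P2)%E.-integrable setT (EFin \o f).
Proof. exact: bm_integrable. Qed.

Lemma bm_Rintegral1 : bounded_measurable (fun x => \int[P2]_y f (x, y)).
Proof.
split.
  apply: (measurableT_comp (f := fine)); first by [].
  exact: measurable_fubini_F intf.
have [_ [B fB]] := bf; exists B => x.
apply: le_trans (le_normr_Rintegral _ _) _ => //; first exact/bm_integrable/bm_pair1.
rewrite -[leRHS](RintegralP_cst P2); apply: bm_le_Rintegral.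
- have [m [C H]] := bm_pair1 x; split; first exact: measurableT_comp.
  by exists C => y; rewrite normr_id.
- exact: bm_cst.
- by move=> y; exact: fB.
Qed.

Lemma bm_Fubini1 : \int[P1]_x \int[P2]_y f (x, y) = \int[(P1 \x P2)%E]_z f z.
Proof.
apply/EFin_inj; rewrite (EFin_bm_Rintegral _ bm_Rintegral1).
rewrite EFin_bm_Rintegral// -integral12_prod_meas1//.
by apply: eq_integral => x _; rewrite EFin_bm_Rintegral//; exact: bm_pair1.
Qed.

End Fubini.

Lemma bm_Fubini d1 d2 (T1 : measurableType d1) (T2 : measurableType d2)
    (P1 : probability T1 R) (P2 : probability T2 R) (f : T1 * T2 -> R) :
  bounded_measurable f ->
  \int[P1]_x \int[P2]_y f (x, y) = \int[P2]_y \int[P1]_x f (x, y).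
Proof.
move=> bf; have bs : bounded_measurable (fun p : T2 * T1 => f (p.2, p.1)).
  apply: (@bm_comp _ _ _ _ (fun p : T2 * T1 => (p.2, p.1))) => //.
  by apply: measurable_fun_pair; [exact: measurable_snd|exact: measurable_fst].
apply/EFin_inj.
rewrite (EFin_bm_Rintegral _ (bm_Rintegral1 P1 P2 bf)).
rewrite (EFin_bm_Rintegral _ (bm_Rintegral1 P2 P1 bs)).
transitivity (\int[P1]_x \int[P2]_y (f (x, y))%:E)%E.
  by apply: eq_integral => x _; rewrite EFin_bm_Rintegral//; exact: bm_pair1.
rewrite (Fubini (bm_integrable (P1 \x P2)%E bf)).
apply: eq_integral => y _; rewrite /= -EFin_bm_Rintegral//; exact: (bm_pair2 bf).
Qed.

End bounded_measurable.

(** * A replica bound *)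

Section replica.
Context {R : realType} dU dV (U : measurableType dU) (V : measurableType dV).
Variables (P : probability U R) (Q : probability V R).

(** The Gram kernel in L^2(Q) of the features J(u, .). For a likelihood ratio [J] it is the second
    moment conditioned on a pair of spikes. *)
Definition overlap_kernel (J : U * V -> R) (u u' : U) : R :=
  \int[Q]_w (J (u, w) * J (u', w)).

Section one_feature.
Variables (J : U * V -> R) (bJ : bounded_measurable J).
Variables (a : U -> R) (ba : bounded_measurable a).

Let v (w : V) : R := \int[P]_u (a u * J (u, w)).

Let baJ : bounded_measurable (fun p : U * V => a p.1 * J p).
Proof. by apply: bmM => //; exact: (bm_comp measurable_fst ba). Qed.

Let bv : bounded_measurable v.
Proof.
apply: (@bm_Rintegral1 _ _ _ _ _ Q P (fun p : V * U => a p.2 * J (p.2, p.1))).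
apply: (@bm_comp _ _ _ _ _ (fun p : V * U => (p.2, p.1)) _ _ baJ).
by apply: measurable_fun_pair; [exact: measurable_snd|exact: measurable_fst].
Qed.

Lemma bm_overlap_kernel : bounded_measurable (fun p : U * U => overlap_kernel J p.1 p.2).
Proof.
apply: (@bm_Rintegral1 _ _ _ _ _ (P \x P)%E Q
  (fun q : (U * U) * V => J (q.1.1, q.2) * J (q.1.2, q.2))).
have m1 : measurable_fun setT (fun q : (U * U) * V => (q.1.1, q.2)).
  apply: measurable_fun_pair => //.
  by apply: measurableT_comp measurable_fst _; exact: measurable_fst.
have m2 : measurable_fun setT (fun q : (U * U) * V => (q.1.2, q.2)).
  apply: measurable_fun_pair => //.
  by apply: measurableT_comp measurable_snd _; exact: measurable_fst.
by apply: bmM; [exact: (bm_comp m1 bJ)|exact: (bm_comp m2 bJ)].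
Qed.

(** Squaring an average over [u] introduces an independent replica [u']; Fubini then carries the
    integral over [w] inside. *)
Let second_moment :
  \int[Q]_w (v w ^+ 2) =
  \int[P]_u \int[P]_u' (a u * a u' * overlap_kernel J u u').
Proof.
transitivity (\int[Q]_w \int[P]_u (v w * (a u * J (u, w)))).
  apply: eq_Rintegral => w _; rewrite bm_RintegralZ ?expr2//.
  exact: (bm_pair2 baJ).
rewrite -(@bm_Fubini _ _ _ _ _ P Q (fun p => v p.2 * (a p.1 * J p))); last first.
  by apply: bmM => //; exact: (bm_comp measurable_snd bv).
apply: eq_Rintegral => u _.
transitivity (\int[Q]_w \int[P]_u' (a u * J (u, w) * (a u' * J (u', w)))).
  apply: eq_Rintegral => w _; rewrite bm_RintegralZ 1?mulrC//.
  exact: (bm_pair2 baJ).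
rewrite -(@bm_Fubini _ _ _ _ _ P Q
    (fun p => a u * J (u, p.2) * (a p.1 * J p))); last first.
  apply: bmM => //; apply: bmZ.
  exact: (bm_comp measurable_snd (bm_pair1 bJ u)).
apply: eq_Rintegral => u' _; rewrite -bm_RintegralZ.
  by apply: eq_Rintegral => w _ /=; ring.
by apply: bmM; exact: (bm_pair1 bJ).
Qed.

(** By Fubini the left side is the integral of p v, and p v <= s p^2 / 2 + v^2 / (2 s) pointwise.
    Leaving [s] free gives Cauchy-Schwarz without square roots. *)
Lemma replica_bound1 (p : V -> R) (s : R) : 0 < s -> bounded_measurable p ->
  \int[P]_u \int[Q]_w (a u * p w * J (u, w)) <=
  s / 2 * \int[Q]_w (p w ^+ 2) +
  (2 * s)^-1 * \int[P]_u \int[P]_u' (a u * a u' * overlap_kernel J u u').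
Proof.
move=> s0 bp; have bp' : bounded_measurable (fun q : U * V => p q.2).
  exact: (bm_comp measurable_snd bp).
rewrite (@bm_Fubini _ _ _ _ _ P Q (fun q => a q.1 * p q.2 * J q)); last first.
  by apply: bmM => //; apply: bmM => //; exact: (bm_comp measurable_fst ba).
under eq_Rintegral => w _.
  rewrite (_ : Rintegral _ _ _ = p w * v w); last first.
    rewrite -bm_RintegralZ; last exact: (bm_pair2 baJ).
    by apply: eq_Rintegral => u _ /=; ring.
  over.
have bp2 : bounded_measurable (fun w => p w ^+ 2) by exact: bmM.
have bv2 : bounded_measurable (fun w => v w ^+ 2) by exact: bmM.
rewrite -second_moment -!bm_RintegralZ// -bm_RintegralD; try exact: bmZ.
apply: bm_le_Rintegral; [exact: bmM|by apply: bmD; exact: bmZ|].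
move=> w; rewrite -subr_ge0.
rewrite (_ : _ - _ = (2 * s)^-1 * (s * p w - v w) ^+ 2); last first.
  by field; rewrite gt_eqF.
by rewrite mulr_ge0 ?sqr_ge0// invr_ge0 mulr_ge0// ltW.
Qed.

End one_feature.

(** The index set accommodates both uses: a single index for a test, the coordinates of a tensor for
    an estimator. Summing the one-feature bounds, the terms in [p] add up to at most s / 2. *)
Lemma replica_bound (I : finType) (J : U * V -> R) (a : I -> U -> R)
    (p : I -> V -> R) (s : R) :
  0 < s -> bounded_measurable J -> (forall i, bounded_measurable (a i)) ->
  (forall i, bounded_measurable (p i)) ->
  (forall w, \sum_i p i w ^+ 2 <= 1) ->
  \int[P]_u \int[Q]_w ((\sum_i a i u * p i w) * J (u, w)) <=
  s / 2 + (2 * s)^-1 *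
    \int[(P \x P)%E]_z ((\sum_i a i z.1 * a i z.2) * overlap_kernel J z.1 z.2).
Proof.
move=> s0 bJ ba bp p1.
have bapJ i : bounded_measurable (fun q : U * V => a i q.1 * p i q.2 * J q).
  apply: bmM => //; apply: bmM.
    exact: (bm_comp measurable_fst (ba i)).
  exact: (bm_comp measurable_snd (bp i)).
have baaK i : bounded_measurable
    (fun z : U * U => a i z.1 * a i z.2 * overlap_kernel J z.1 z.2).
  apply: bmM; last exact: bm_overlap_kernel.
  by apply: bmM; [exact: (bm_comp measurable_fst (ba i))|
                  exact: (bm_comp measurable_snd (ba i))].
have bp2 i : bounded_measurable (fun w => p i w ^+ 2) by exact: bmM.
rewrite (_ : (\int[P]_u _)%R =
    \sum_i \int[P]_u \int[Q]_w (a i u * p i w * J (u, w))); last first.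
  rewrite -bm_Rintegral_sum; last by move=> i; exact: (bm_Rintegral1 P Q (bapJ i)).
  apply: eq_Rintegral => u _; rewrite -bm_Rintegral_sum; last first.
    by move=> i; exact: (bm_pair1 (bapJ i)).
  by apply: eq_Rintegral => w _; rewrite mulr_suml.
rewrite (_ : (\int[(P \x P)%E]_z _)%R =
    \sum_i \int[P]_u \int[P]_u' (a i u * a i u' * overlap_kernel J u u')); last first.
  transitivity (\int[(P \x P)%E]_z
      (\sum_i a i z.1 * a i z.2 * overlap_kernel J z.1 z.2)).
    by apply: eq_Rintegral => z _; rewrite mulr_suml.
  by rewrite bm_Rintegral_sum//; apply: eq_bigr => i _; rewrite -(bm_Fubini1 P P (baaK i)).
apply: (@le_trans _ _ (s / 2 * (\sum_i \int[Q]_w (p i w ^+ 2)) + (2 * s)^-1 *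
    \sum_i \int[P]_u \int[P]_u' (a i u * a i u' * overlap_kernel J u u'))).
  rewrite !mulr_sumr -big_split/=; apply: ler_sum => i _.
  exact: replica_bound1.
rewrite lerD2r ler_piMr//; first by rewrite divr_ge0// ltW.
rewrite -bm_Rintegral_sum// -[leRHS](RintegralP_cst Q).
by apply: bm_le_Rintegral => //; [exact: bm_sum|exact: bm_cst].
Qed.

End replica.

(** * Tensors and the truncated likelihood *)

Section tensor_algebra.
Context {R : realType}.

Definition scale_tuple n (a : R) (h : n.-tuple R) : n.-tuple R :=
  [tuple a * tnth h i | i < n].

Lemma inner_scalel n (a : R) (h w : n.-tuple R) :
  inner (scale_tuple a h) w = a * inner h w.
Proof.
by rewrite /inner mulr_sumr; apply: eq_bigr => i _; rewrite tnth_mktuple mulrA.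
Qed.

Lemma inner_shiftl n (h h' w : n.-tuple R) :
  inner (shift_tuple h h') w = inner h w + inner h' w.
Proof.
by rewrite /inner -big_split; apply: eq_bigr => i _; rewrite tnth_mktuple mulrDl.
Qed.

Lemma inner_tensorE n d (S T : tensor R n d) :
  inner S T = \sum_(i : multi_index n d) entry S i * entry T i.
Proof.
rewrite /inner (reindex (@enum_rank (multi_index n d)))//=.
by exists enum_val => i _; rewrite ?enum_rankK ?enum_valK.
Qed.

(** Distributivity: a product of [d] sums over coordinates expands into a sum over all
    multi-indices. *)
Lemma inner_tensor_pow n d (x y : n.-tuple R) :
  inner (tensor_pow d x) (tensor_pow d y) = inner x y ^+ d.
Proof.
rewrite inner_tensorE -[d in RHS]card_ord -prodr_const.
rewrite /inner (bigA_distr_bigA (fun _ i => tnth x i * tnth y i)).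
apply: eq_bigr => i _; rewrite !entry_mk_tensor -big_split.
by apply: eq_bigl => k.
Qed.

(** Symmetrization is linear and fixes the tensor power of x, because permuting the indices only
    permutes the factors of each entry. *)
Lemma spike_symmetrize n d (lambda : R) (x : n.-tuple R) (w : tensor R n d) :
  spike lambda (x, symmetrize w) =
  symmetrize (shift_tuple (scale_tuple lambda (tensor_pow d x)) w).
Proof.
congr mk_tensor; apply/funext => i; rewrite [entry (symmetrize w) i]entry_mk_tensor.
have pow_perm (s : 'S_d) :
    entry (tensor_pow d x) [ffun k => i (s k)] = \prod_(k < d) tnth x (i k).
  rewrite entry_mk_tensor [RHS](reindex_perm s).
  by apply: eq_bigr => k _; rewrite ffunE.
have entry_shift (s : 'S_d) :
    entry (shift_tuple (scale_tuple lambda (tensor_pow d x)) w) [ffun k => i (s k)] =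
    lambda * \prod_(k < d) tnth x (i k) + entry w [ffun k => i (s k)].
  by rewrite -(pow_perm s) /entry tnth_mktuple tnth_mktuple.
rewrite [in RHS](eq_bigr _ (fun s _ => entry_shift s)).
rewrite big_split/= sumr_const card_Sn mulrDr; congr (_ + _).
rewrite mulrnAr -mulr_natl mulrA divff ?mul1r ?entry_mk_tensor//.
Qed.

Lemma measurable_tensor_pow n d :
  measurable_fun [set: n.-tuple R] (@tensor_pow R n d).
Proof.
apply: measurable_mk_tensor => i; apply: measurable_prod => k _.
exact: measurable_tnth.
Qed.

End tensor_algebra.

(** * The truncated likelihood ratio and its second moment *)

Section truncated_likelihood.
Context {R : realType} (n d : nat) (v lambda delta : R).
Hypotheses (v0 : 0 < v) (lambda_ge0 : 0 <= lambda) (delta_gt0 : 0 < delta).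

Local Notation V := (tensor R n d).
Local Notation Q := (iid (gaussian 0 v) #|{: multi_index n d}|).
Local Notation pow x := (tensor_pow d x).

(** The exponential is the likelihood ratio of the spike only for a unit vector; setting it to 0
    elsewhere lets the bounds on the mass and on the kernel hold for all vectors. *)
Definition truncated_likelihood (p : n.-tuple R * V) : R :=
  if (inner p.1 p.1 == 1) && (inner (pow p.1) p.2 <= lambda + delta)
  then expR ((lambda * inner (pow p.1) p.2 - lambda ^+ 2 / 2) / v) else 0.
Local Notation K := truncated_likelihood.

Lemma truncated_likelihood_ge0 p : 0 <= K p.
Proof. by rewrite /K; case: ifP => // _; exact: expR_ge0. Qed.

Lemma bm_truncated_likelihood : bounded_measurable K.
Proof.
have mL : measurable_fun [set: n.-tuple R * V] (fun p => inner (pow p.1) p.2).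
  apply: (measurableT_comp (@measurable_inner R _)
    (g := fun p : n.-tuple R * V => (pow p.1, p.2))).
  apply: measurable_fun_pair => //.
  by apply: measurableT_comp; [exact: measurable_tensor_pow|exact: measurable_fst].
split.
  apply: measurable_fun_ifT => //.
    apply: measurable_and; last exact: measurable_fun_ler.
    apply: measurable_fun_eqr => //.
    by apply: (measurableT_comp (@measurable_innerxx R n)); exact: measurable_fst.
  apply: measurableT_comp => //; apply: measurable_funM => //.
  by apply: measurable_funB => //; exact: measurable_funM.
exists (expR ((lambda * (lambda + delta) - lambda ^+ 2 / 2) / v)) => p.
rewrite ger0_norm ?truncated_likelihood_ge0// /K.
case: ifP => [/andP[_ pl]|_]; last exact: expR_ge0.
by rewrite ler_expR ler_pM2r ?invr_gt0// lerD2r ler_wpM2l.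
Qed.

Lemma inner_scale_tensor_pow (x : n.-tuple R) (a : R) : inner x x = 1 ->
  inner (scale_tuple a (pow x)) (scale_tuple a (pow x)) = a ^+ 2.
Proof.
move=> x1; rewrite inner_scalel innerC inner_scalel inner_tensor_pow x1.
by rewrite expr1n mulr1 expr2.
Qed.

Lemma tilt_spike (x : n.-tuple R) w : inner x x = 1 ->
  tilt v (scale_tuple lambda (pow x)) w =
  expR ((lambda * inner (pow x) w - lambda ^+ 2 / 2) / v).
Proof.
move=> x1; rewrite /tilt inner_scale_tensor_pow// inner_scalel; congr expR.
by field; rewrite gt_eqF.
Qed.

Lemma truncated_likelihood_integral_le1 x : \int[Q]_w K (x, w) <= 1.
Proof.
rewrite -lee_fin EFin_bm_Rintegral; last exact: (bm_pair1 bm_truncated_likelihood).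
have mK : measurable_fun setT (fun w => (K (x, w))%:E).
  by apply/measurable_EFinP; have [] := bm_pair1 bm_truncated_likelihood x.
have [x1|x1] := eqVneq (inner x x) 1; last first.
  rewrite integral0_eq// => w _; by rewrite /K /= (negbTE x1).
rewrite -(@integral_tilt _ v v0 _ (scale_tuple lambda (pow x))).
apply: ge0_le_integral => //.
- by move=> w _; rewrite lee_fin truncated_likelihood_ge0.
- by apply/measurable_EFinP; exact: measurable_tilt.
- move=> w _; rewrite lee_fin tilt_spike// /K /=.
  by case: ifP => // _; exact: expR_ge0.
Qed.

(* Chernoff's bound with parameter delta controls the mass outside the truncation. *)
Lemma planted_le_truncated (x : n.-tuple R) (G : V -> R) (B : R) :
  inner x x = 1 -> measurable_fun setT G -> (forall w, 0 <= G w <= B) ->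
  \int[Q]_w G (shift_tuple (scale_tuple lambda (pow x)) w) <=
  \int[Q]_w (G w * K (x, w)) + B * expR (- delta ^+ 2 / (2 * v)).
Proof.
move=> x1 mG GB; set h := scale_tuple lambda (pow x).
have bG : bounded_measurable G.
  by split=> //; exists B => w; have /andP[? ?] := GB w; rewrite ger0_norm.
have bGK : bounded_measurable (fun w => G w * K (x, w)).
  by apply: bmM => //; exact: (bm_pair1 bm_truncated_likelihood).
have B0 : 0 <= B by have /andP[/le_trans] := GB h; apply.
rewrite -lee_fin EFinD EFin_bm_Rintegral; last first.
  by apply: bm_comp bG; exact: measurable_shift_tuple.
rewrite EFin_bm_Rintegral//.
rewrite (@ge0_integral_iid_shift _ v v0 _ h (EFin \o G)); last 2 first.
- exact/measurable_EFinP.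
- by move=> w; rewrite lee_fin; have /andP[] := GB w.
(* [k] is the value for which [E w * expR (- k / v)] meets the likelihood ratio at the threshold
   lambda + delta and dominates it beyond. The mean of [E] cancels the first summand of [k], leaving
   exp (- delta^2 / (2 v)). *)
pose k := (lambda + delta) * (lambda + delta) / 2 + delta ^+ 2 / 2.
pose E w := expR (inner (scale_tuple (lambda + delta) (pow x)) w / v).
have mE : measurable_fun setT E.
  apply: measurableT_comp => //; apply: measurable_funM => //.
  exact: measurable_innerr.
apply: (@le_trans _ _ (\int[Q]_w ((G w * K (x, w))%:E +
    (E w)%:E * (B * expR (- k / v))%:E))%E).
  apply: ge0_le_integral => //.
  - move=> w _; rewrite mule_ge0//; first by rewrite lee_fin; have /andP[] := GB w.
    exact: tilt_ge0.
  - apply: emeasurable_funM; apply/measurable_EFinP => //; exact: measurable_tilt.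
  - apply: emeasurable_funD; first by apply/measurable_EFinP; case: bGK.
    by apply: emeasurable_funM => //; exact/measurable_EFinP.
  move=> w _ /=; rewrite -!EFinM -EFinD lee_fin tilt_spike// /K /= x1 eqxx/=.
  have /andP[Gw0 GwB] := GB w.
  have ? : 0 <= E w * (B * expR (- k / v)) by rewrite !mulr_ge0 ?expR_ge0.
  case: ifPn => [_|]; first by rewrite lerDl.
  rewrite -ltNge => wl; rewrite mulr0 add0r mulrCA.
  apply: ler_pM => //; rewrite ?expR_ge0//.
  rewrite /E -expRD ler_expR -mulrDl ler_pM2r ?invr_gt0// inner_scalel /k.
  set t := inner _ _ in wl *.
  have : 0 <= delta * (t - (lambda + delta)) by rewrite mulr_ge0 ?subr_ge0 ?ltW.
  lra.
rewrite ge0_integralD//; last 4 first.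
- by move=> w _; rewrite lee_fin mulr_ge0 ?truncated_likelihood_ge0//; have /andP[] := GB w.
- by apply/measurable_EFinP; case: bGK.
- by move=> w _; rewrite mule_ge0 ?lee_fin ?expR_ge0// mulr_ge0 ?expR_ge0.
- by apply: emeasurable_funM => //; exact/measurable_EFinP.
rewrite leeD2l// ge0_integralZr//; last 3 first.
- exact/measurable_EFinP.
- by move=> w _; rewrite lee_fin expR_ge0.
- by rewrite lee_fin mulr_ge0 ?expR_ge0.
rewrite iid_gaussian_mgf// inner_scale_tensor_pow// -EFinM lee_fin mulrCA.
rewrite ler_wpM2l// -expRD ler_expR /k le_eqVlt; apply/orP; left; apply/eqP.
by field; rewrite gt_eqF.
Qed.

(* Chernoff again: a = lambda drops the truncation, a = lambda / 2 is the optimal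
   choice for two equal spikes. *)
Lemma overlap_truncated_likelihood_le (a : R) (x x' : n.-tuple R) : a <= lambda ->
  overlap_kernel Q K x x' <=
  expR ((a ^+ 2 * (1 + inner x x' ^+ d) + 2 * (lambda - a) * (lambda + delta)
    - lambda ^+ 2) / v).
Proof.
move=> al.
have bKK : bounded_measurable (fun w => K (x, w) * K (x', w)).
  by apply: bmM; exact: (bm_pair1 bm_truncated_likelihood).
have KK0 w : 0 <= K (x, w) * K (x', w) by rewrite mulr_ge0 ?truncated_likelihood_ge0.
rewrite -lee_fin EFin_bm_Rintegral//.
have [x1|x1] := eqVneq (inner x x) 1; last first.
  rewrite integral0_eq ?lee_fin ?expR_ge0// => w _.
  by rewrite /K /= (negbTE x1)/= mul0r.
have [x'1|x'1] := eqVneq (inner x' x') 1; last first.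
  rewrite integral0_eq ?lee_fin ?expR_ge0// => w _.
  by rewrite /K /= (negbTE x'1)/= mulr0.
pose h := scale_tuple a (shift_tuple (pow x) (pow x')).
(* On both truncation events, lambda (t + t') <= a (t + t') + 2 (lambda - a) (lambda + delta); only
   the part with factor [a] is left to the moment generating function. *)
pose c := (2 * (lambda - a) * (lambda + delta) - lambda ^+ 2) / v.
apply: (@le_trans _ _ (\int[Q]_w ((expR (inner h w / v))%:E * (expR c)%:E))%E).
  apply: ge0_le_integral => //.
  - by move=> w _; rewrite lee_fin.
  - by apply/measurable_EFinP; case: bKK.
  - apply: emeasurable_funM => //; apply/measurable_EFinP.
    apply: measurableT_comp => //; apply: measurable_funM => //.
    exact: measurable_innerr.
  move=> w _; rewrite -EFinM lee_fin /K /= x1 x'1 !eqxx/=.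
  have e0 : 0 <= expR (inner h w / v) * expR c by rewrite mulr_ge0 ?expR_ge0.
  case: ifP => wl; last by rewrite mul0r.
  case: ifP => wl'; last by rewrite mulr0.
  rewrite -!expRD ler_expR -!mulrDl ler_pM2r ?invr_gt0//.
  rewrite inner_scalel inner_shiftl.
  move: wl wl'; set t := inner _ _; set t' := inner _ _ => wl wl'.
  have ? : (lambda - a) * (t + t') <= (lambda - a) * (2 * (lambda + delta)).
    by rewrite ler_wpM2l ?subr_ge0//; lra.
  lra.
rewrite ge0_integralZr//; last first.
  apply/measurable_EFinP; apply: measurableT_comp => //.
  by apply: measurable_funM => //; exact: measurable_innerr.
rewrite iid_gaussian_mgf// -EFinM lee_fin -expRD ler_expR le_eqVlt; apply/orP; left.
rewrite inner_scalel innerC inner_scalel inner_shiftl.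
rewrite !(innerC _ (shift_tuple _ _)) !inner_shiftl (innerC (pow x') (pow x)).
rewrite !inner_tensor_pow x1 x'1 !expr1n /c; apply/eqP.
by field; rewrite gt_eqF.
Qed.

End truncated_likelihood.

(** * Bounds in fixed dimension *)

Section transfer.
Context {R : realType}.

Lemma bm_le_Rintegral_on d (T : measurableType d) (P : probability T R)
    (A : set T) (f g : T -> R) : measurable A -> P A = 1%E ->
  bounded_measurable f -> bounded_measurable g ->
  (forall x, A x -> f x <= g x) -> \int[P]_x f x <= \int[P]_x g x.
Proof.
move=> mA PA bf bg fg.
have PcA : P (~` A) = 0%E by rewrite probability_setC// PA subee.
have mcA : measurable (~` A) by exact: measurableC.
have restrict h : bounded_measurable h -> \int[P]_x h x = \int[P]_(x in A) h x.
  move=> bh; rewrite /Rintegral (negligible_integral mcA)//; last exact: bm_integrable.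
  by rewrite setTD setCK.
rewrite !restrict//; apply: le_Rintegral => //.
- by apply: integrableS (bm_integrable P bf).
- by apply: integrableS (bm_integrable P bg).
Qed.

Lemma bm_Rintegral_distribution d d' (T : measurableType d) (T' : measurableType d')
    (P : probability T R) (X : {mfun T >-> T'}) (f : T' -> R) :
  bounded_measurable f -> \int[distribution P X]_y f y = \int[P]_x f (X x).
Proof.
move=> bf; rewrite /Rintegral integral_distribution//.
  by apply/measurable_EFinP; case: bf.
by apply: (bm_integrable P (f := f \o X)); exact: bm_comp.
Qed.

Lemma bm_indic d (T : measurableType d) (A : set T) : measurable A ->
  bounded_measurable (\1_A : T -> R).
Proof.
move=> mA; split; first exact: measurable_indic.
by exists 1 => x; rewrite ger0_norm// indicE; case: (_ \in _).
Qed.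

Lemma Rintegral_indicE d (T : measurableType d) (P : probability T R) (A : set T) :
  measurable A -> (\int[P]_x \1_A x)%:E = P A.
Proof.
by move=> mA; rewrite EFin_bm_Rintegral ?integral_indic ?setIT//; exact: bm_indic.
Qed.

Lemma inner_unit_le1 n (x y : n.-tuple R) :
  inner x x = 1 -> inner y y = 1 -> `|inner x y| <= 1.
Proof.
move=> x1 y1.
(* Expand the squared norm of x + a y; the values a = 1 and a = -1 give the two bounds. *)
have sq (a : R) : 0 <= inner x x + a * inner x y *+ 2 + a ^+ 2 * inner y y.
  rewrite (_ : _ + _ = \sum_(i < n) (tnth x i + a * tnth y i) ^+ 2).
    by apply: sumr_ge0 => i _; rewrite sqr_ge0.
  rewrite /inner !mulr_sumr -sumrMnl -!big_split/=; apply: eq_bigr => i _; ring.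
have := sq 1; have := sq (-1); rewrite x1 y1 ler_norml => *; apply/andP; split; lra.
Qed.

End transfer.

(** * Detection and recovery errors in a fixed dimension *)

Section finite_dimension.
Context {R : realType} (n d : nat) (lambda delta : R).
Hypotheses (n0 : (0 < n)%N) (lambda_ge0 : 0 <= lambda) (delta_gt0 : 0 < delta).
Variables (X : forall n, probability (n.-tuple R) R) (X1 : on_unit_vectors X).

Local Notation V := (tensor R n d).
Local Notation U := (n.-tuple R).
Local Notation P := (X n).
Local Notation v := (2 / n%:R : R).
Local Notation Q := (iid (gaussian 0 v) #|{: multi_index n d}|).
Local Notation K := (@truncated_likelihood R n d v lambda delta).
Local Notation pow x := (tensor_pow d x).
Local Notation beta := (expR (- delta ^+ 2 / (2 * v))).

Let v0 : 0 < v. Proof. by rewrite divr_gt0// ltr0n. Qed.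

Let bK : bounded_measurable K.
Proof. exact: bm_truncated_likelihood. Qed.

Let measurable_unit : measurable [set x : U | unit_vector x].
Proof.
rewrite (_ : mkset _ = [set x : U | inner x x == 1]); last first.
  by apply/seteqP; split=> x /=; [move/eqP|move=> /eqP].
rewrite -[X in measurable X]setTI.
have : measurable_fun [set: U] (fun x => inner x x == 1).
  by apply: measurable_fun_eqr => //; exact: measurable_innerxx.
by move=> /(_ measurableT [set true]); apply.
Qed.

Lemma Rintegral_WT (f : U * V -> R) : bounded_measurable f ->
  \int[(P \x WT n d)%E]_p f p = \int[P]_x \int[Q]_w f (x, symmetrize w).
Proof.
move=> bf; transitivity (\int[P]_x \int[WT n d]_T f (x, T)).
  exact/esym/(bm_Fubini1 P (WT n d) bf).
apply: eq_Rintegral => x _.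
by rewrite /WT bm_Rintegral_distribution//; exact: (bm_pair1 bf).
Qed.

Let bm_sym (f : U * V -> R) : bounded_measurable f ->
  bounded_measurable (fun p : U * V => f (p.1, symmetrize p.2)).
Proof.
move=> bf; apply: (@bm_comp _ _ _ _ _ (fun p : U * V => (p.1, symmetrize p.2)) _ _ bf).
apply: measurable_fun_pair => //.
by apply: measurableT_comp; [exact: measurable_symmetrize|exact: measurable_snd].
Qed.

Let bm_spike (f : U * V -> R) : bounded_measurable f ->
  bounded_measurable (fun p : U * V => f (p.1, spike lambda p)).
Proof.
move=> bf; apply: (@bm_comp _ _ _ _ _ (fun p : U * V => (p.1, spike lambda p)) _ _ bf).
by apply: measurable_fun_pair => //; exact: measurable_spike.
Qed.

(** Adding the spike commutes with symmetrization, so the change of measure applies to G(x, .)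
    composed with [symmetrize], for each unit spike; then average over the prior. *)
Lemma planted_le (G : U * V -> R) (B : R) :
  bounded_measurable G -> (forall p, 0 <= G p <= B) ->
  \int[(P \x WT n d)%E]_p G (p.1, spike lambda p) <=
  \int[P]_x \int[Q]_w (G (x, symmetrize w) * K (x, w)) + B * beta.
Proof.
move=> bG GB; rewrite (Rintegral_WT (bm_spike bG)) /=.
have bGK : bounded_measurable (fun p : U * V => G (p.1, symmetrize p.2) * K p).
  by apply: bmM => //; exact: bm_sym.
have bI := bm_Rintegral1 P Q bGK.
rewrite -[X in _ <= _ + X](RintegralP_cst P) -bm_RintegralD//; last exact: bm_cst.
apply: (@bm_le_Rintegral_on _ _ _ _ [set x : U | unit_vector x]) => //.
- exact: X1.
- exact: (bm_Rintegral1 P Q (bm_sym (bm_spike bG))).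
- by apply: bmD => //; exact: bm_cst.
move=> x /= x1; under eq_Rintegral do rewrite spike_symmetrize.
apply: (planted_le_truncated v0 lambda_ge0 delta_gt0
  (G := fun w => G (x, symmetrize w)) x1) => //.
by have [] := bm_pair1 (bm_sym bG) x.
Qed.

Let m : R := \int[P]_x \int[Q]_w K (x, w).

Let m_le1 : m <= 1.
Proof.
rewrite -[leRHS](RintegralP_cst P); apply: bm_le_Rintegral.
- exact: (bm_Rintegral1 P Q bK).
- exact: bm_cst.
- by move=> x; exact: truncated_likelihood_integral_le1.
Qed.

(** Taking the constant function 1 in [planted_le] shows that truncation loses at most [beta] of the
    planted mass. *)
Let m_ge : 1 - beta <= m.
Proof.
have cst1 (p : U * V) : 0 <= (cst 1 : U * V -> R) p <= 1 by rewrite ler01 lexx.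
have := planted_le (bm_cst _ 1) cst1.
rewrite RintegralP_cst mul1r -lerBlDr => /le_trans; apply.
rewrite le_eqVlt; apply/orP; left; apply/eqP.
by apply: eq_Rintegral => x _; apply: eq_Rintegral => w _; rewrite mul1r.
Qed.

(** [q] stands for a majorant of the excess second moment, constructed later from the overlap tails.
    Its first property serves detection, the second recovery. *)
Variables (q : U * U -> R) (bq : bounded_measurable q) (q0 : forall z, 0 <= q z).
Hypothesis overlap_le : forall x x', inner x x = 1 -> inner x' x' = 1 ->
  overlap_kernel Q K x x' <= 1 + q (x, x') /\
  inner x x' ^+ d * overlap_kernel Q K x x' <= q (x, x').
Local Notation eps := (\int[(P \x P)%E]_z q z).

Let overlap_nonunit x x' : (inner x x != 1) || (inner x' x' != 1) ->
  overlap_kernel Q K x x' = 0.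
Proof.
move=> xx; rewrite /overlap_kernel -[RHS](RintegralP_cst Q).
apply: eq_Rintegral => w _; rewrite /truncated_likelihood/=.
by case/orP: xx => /negbTE ->; rewrite /= ?mul0r ?mulr0.
Qed.

Let bM := bm_overlap_kernel P Q bK.

Let second_moment_le : \int[(P \x P)%E]_z overlap_kernel Q K z.1 z.2 <= 1 + eps.
Proof.
rewrite -[X in X + _](RintegralP_cst (P \x P)%E) -bm_RintegralD//; last exact: bm_cst.
apply: bm_le_Rintegral => //; first by apply: bmD => //; exact: bm_cst.
move=> -[x x']/=; have [x1|x1] := eqVneq (inner x x) 1; last first.
  by rewrite overlap_nonunit ?x1// addr_ge0.
have [x'1|x'1] := eqVneq (inner x' x') 1; last first.
  by rewrite overlap_nonunit ?x'1 ?orbT// addr_ge0.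
by have [] := overlap_le x1 x'1.
Qed.

(** The replica bound for the centred feature K - 1: its kernel integrates to E[K K'] - 2 m + 1,
    which is at most eps + 2 beta since E[K K'] <= 1 + eps and m >= 1 - beta. *)
Lemma detection_bound (A : set V) (s : R) : measurable A -> 0 < s ->
  (spikedWT X n d lambda A <=
   WT n d A + (s / 2 + (2 * s)^-1 * (eps + 2 * beta) + beta)%:E)%E.
Proof.
move=> mA s0; rewrite -!Rintegral_indicE// -EFinD lee_fin.
have bA : bounded_measurable (\1_A : V -> R) := bm_indic mA.
rewrite /spikedWT bm_Rintegral_distribution//.
have bA2 : bounded_measurable (fun p : U * V => (\1_A : V -> R) p.2).
  exact: (bm_comp measurable_snd bA).
apply: le_trans (planted_le (B := 1) bA2 _) _.
  by move=> p; rewrite indicE; case: (_ \in _); rewrite ?lexx ler01.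
rewrite /WT bm_Rintegral_distribution// mul1r addrA lerD2r.
pose g (w : V) : R := \1_A (symmetrize w).
have bg : bounded_measurable g by exact: (bm_comp (@measurable_symmetrize R n d) bA).
have bg2 : bounded_measurable (fun p : U * V => g p.2) := bm_comp measurable_snd bg.
pose J (p : U * V) := K p - 1.
have bJ : bounded_measurable J by apply: bmB => //; exact: bm_cst.
have := @replica_bound R _ _ _ _ P Q unit J (fun=> cst 1) (fun=> g) s s0 bJ
  (fun=> bm_cst _ _) (fun=> bg).
have g1 (w : V) : \sum_(i : unit) g w ^+ 2 <= 1.
  rewrite big_const card_unit /= addr0 /g indicE.
  by case: (_ \in _); rewrite ?expr1n// expr0n.
move=> /(_ g1).
have -> : \int[P]_u \int[Q]_w ((\sum_(i : unit) 1 * g w) * J (u, w)) =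
    \int[P]_x \int[Q]_w (g w * K (x, w)) - \int[Q]_w g w.
  rewrite -[X in _ - X](RintegralP_cst P) -bm_RintegralB; first last.
  - exact: bm_cst.
  - by apply: (bm_Rintegral1 P Q (f := fun p => g p.2 * K p)); exact: bmM.
  apply: eq_Rintegral => x _; rewrite -bm_RintegralB//; last first.
    by apply: bmM => //; exact: (bm_pair1 bK).
  apply: eq_Rintegral => w _.
  by rewrite big_const card_unit /= addr0 mul1r /J mulrBr mulr1.
(* Expanding (K(x, w) - 1) (K(x', w) - 1), each of the two linear terms integrates to [m]. *)
have -> : \int[(P \x P)%E]_z ((\sum_(i : unit) 1 * 1) * overlap_kernel Q J z.1 z.2) =
    \int[(P \x P)%E]_z overlap_kernel Q K z.1 z.2 - 2 * m + 1.
  have bk : bounded_measurable (fun x => \int[Q]_w K (x, w)) := bm_Rintegral1 P Q bK.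
  have bk1 : bounded_measurable (fun z : U * U => \int[Q]_w K (z.1, w)).
    exact: (bm_comp measurable_fst bk).
  have bk2 : bounded_measurable (fun z : U * U => \int[Q]_w K (z.2, w)).
    exact: (bm_comp measurable_snd bk).
  transitivity (\int[(P \x P)%E]_z (overlap_kernel Q K z.1 z.2
      - (\int[Q]_w K (z.1, w) + \int[Q]_w K (z.2, w)) + 1)).
    apply: eq_Rintegral => z _; rewrite big_const card_unit /= addr0 !mul1r.
    rewrite /overlap_kernel -bm_RintegralD; try exact: (bm_pair1 bK).
    rewrite -bm_RintegralB; first last.
    - by apply: bmD; exact: (bm_pair1 bK).
    - by apply: bmM; exact: (bm_pair1 bK).
    rewrite -[X in _ = _ + X](RintegralP_cst Q) -bm_RintegralD; first last.
    - exact: bm_cst.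
    - by apply: bmB; [apply: bmM|apply: bmD]; exact: (bm_pair1 bK).
    by apply: eq_Rintegral => w _; rewrite /J; ring.
  have bk12 := bmD bk1 bk2.
  rewrite (bm_RintegralD (P \x P)%E (bmB bM bk12) (bm_cst _ 1)).
  rewrite (bm_RintegralB (P \x P)%E bM bk12) (bm_RintegralD (P \x P)%E bk1 bk2).
  rewrite RintegralP_cst.
  have e1 : \int[(P \x P)%E]_z \int[Q]_w K (z.1, w) = m.
    transitivity (\int[P]_x \int[P]_y \int[Q]_w K (x, w)).
      exact/esym/(bm_Fubini1 P P bk1).
    by apply: eq_Rintegral => x _; exact: RintegralP_cst.
  have e2 : \int[(P \x P)%E]_z \int[Q]_w K (z.2, w) = m.
    transitivity (\int[P]_x \int[P]_y \int[Q]_w K (y, w)).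
      exact/esym/(bm_Fubini1 P P bk2).
    exact: RintegralP_cst.
  rewrite (_ : 2 * m = m + m); last by ring.
  exact: (f_equal2 (fun s t => _ - (s + t) + 1) e1 e2).
rewrite lerBlDl => /le_trans; apply; rewrite lerD2l lerD2l.
rewrite ler_wpM2l//; first by rewrite invr_ge0 mulr_ge0// ltW.
have := m_ge; have := second_moment_le; lra.
Qed.

(** The quantity <x, xhat>^d is the scalar product of the tensor powers of x and xhat. The replica
    bound over their coordinates weights the kernel by <x, x'>^d, while the power of xhat has norm
    1. *)
Lemma recovery_bound (xhat : {mfun V >-> U}) (s : R) :
  (forall T, unit_vector (xhat T)) -> 0 < s ->
  ('E_(P \x WT n d)[fun p => (inner p.1 (xhat (spike lambda p)) ^+ d)%R] <=
   (s / 2 + (2 * s)^-1 * eps + 2 * beta)%:E)%E.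
Proof.
move=> xhat1 s0.
pose a (i : multi_index n d) (x : U) : R :=
  if inner x x == 1 then entry (pow x) i else 0.
pose p (i : multi_index n d) (T : V) : R := entry (pow (xhat T)) i.
have sq_le1 (x : U) i : inner x x = 1 -> `|entry (pow x) i| <= 1.
  move=> x1; rewrite -(@expr_le1 _ 2)// real_normK ?num_real//.
  have := inner_tensor_pow d x x; rewrite x1 expr1n inner_tensorE => <-.
  rewrite (bigD1 i)//= -expr2 lerDl; apply: sumr_ge0 => j _.
  by rewrite -expr2 sqr_ge0.
have mpow i : measurable_fun [set: U] (fun x => entry (pow x) i).
  by apply: (measurableT_comp (measurable_tnth _)); exact: measurable_tensor_pow.
have ba i : bounded_measurable (a i).
  split; last first.
    exists 1 => x; rewrite /a; case: eqP => [x1|_]; first exact: sq_le1.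
    by rewrite normr0.
  apply: measurable_fun_ifT => //.
  by apply: measurable_fun_eqr => //; exact: measurable_innerxx.
have bp i : bounded_measurable (p i).
  split; last by exists 1 => T; apply: sq_le1; exact: xhat1.
  by apply: (measurableT_comp (mpow i)).
pose H (z : U * V) := \sum_i a i z.1 * p i z.2.
have bH : bounded_measurable H.
  apply: bm_sum => i; apply: bmM.
    exact: (bm_comp measurable_fst (ba i)).
  exact: (bm_comp measurable_snd (bp i)).
have HE x T : inner x x = 1 -> H (x, T) = inner x (xhat T) ^+ d.
  move=> x1; rewrite -inner_tensor_pow inner_tensorE; apply: eq_bigr => i _.
  by rewrite /a x1 eqxx.
have H1 z : `|H z| <= 1.
  case: z => x T; have [x1|x1] := eqVneq (inner x x) 1.
    by rewrite HE// normrX exprn_ile1// inner_unit_le1//; exact: xhat1.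
  rewrite /H big1 ?normr0// => i _; by rewrite /a /= (negbTE x1) mul0r.
have -> : ('E_(P \x WT n d)[fun p => (inner p.1 (xhat (spike lambda p)) ^+ d)%R] =
    (\int[(P \x WT n d)%E]_z H (z.1, spike lambda z))%:E)%E.
  rewrite EFin_bm_Rintegral; last exact: bm_spike.
  rewrite unlock; apply: ae_eq_integral => //.
  - apply/measurable_EFinP; apply: measurable_funX.
    apply: (measurableT_comp (@measurable_inner R n)
      (g := fun p : U * V => (p.1, xhat (spike lambda p)))).
    apply: measurable_fun_pair => //.
    by apply: measurableT_comp => //; exact: measurable_spike.
  - by apply/measurable_EFinP; have [] := bm_spike bH.
  (* Off the unit sphere [a] is set to 0 and the integrands may differ; the prior gives this set
     mass 0. *)
  exists ([set x : U | ~ unit_vector x] `*` [set: V]); split.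
  - by apply: measurableX => //; exact: measurableC.
  - transitivity ((P (~` [set x : U | unit_vector x]) * WT n d setT)%E).
      by apply: product_measure1E => //; exact: measurableC.
    have := probability_setC P measurable_unit; rewrite (X1 n0) subee// => ->.
    by rewrite mul0e.
  - by move=> [x w]/= ne; split=> // x1; apply: ne => _; rewrite HE.
rewrite lee_fin.
(* [planted_le] asks for a nonnegative function: 1 + H lies in [0, 2], whence the error 2 beta, and
   the added 1 contributes m <= 1 on the right. *)
have bH1 : bounded_measurable (fun z => 1 + H z) by apply: bmD => //; exact: bm_cst.
have := planted_le (B := 2) bH1.
rewrite bm_RintegralD ?RintegralP_cst//; [|exact: bm_cst|exact: bm_spike].
have -> : \int[P]_x \int[Q]_w ((1 + H (x, symmetrize w)) * K (x, w)) =
    m + \int[P]_x \int[Q]_w (H (x, symmetrize w) * K (x, w)).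
  have bHK : bounded_measurable (fun z : U * V => H (z.1, symmetrize z.2) * K z).
    by apply: bmM => //; exact: bm_sym.
  rewrite -bm_RintegralD; [|exact: (bm_Rintegral1 P Q bK)|exact: (bm_Rintegral1 P Q bHK)].
  apply: eq_Rintegral => x _; rewrite -bm_RintegralD.
  - by apply: eq_Rintegral => w _; rewrite mulrDl mul1r.
  - exact: (bm_pair1 bK).
  - exact: (bm_pair1 bHK).
have H2 z : 0 <= 1 + H z <= 2.
  by have := H1 z; rewrite ler_norml => /andP[? ?]; apply/andP; split; lra.
move=> /(_ H2).
have bps i : bounded_measurable (fun w : V => p i (symmetrize w)).
  exact: (bm_comp (@measurable_symmetrize R n d) (bp i)).
have := @replica_bound R _ _ _ _ P Q _ K a (fun i w => p i (symmetrize w)) s s0 bK ba bps.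
have p1 (w : V) : \sum_i p i (symmetrize w) ^+ 2 <= 1.
  rewrite (_ : \sum_i _ = inner (pow (xhat (symmetrize w))) (pow (xhat (symmetrize w)))).
    by rewrite inner_tensor_pow (xhat1 _) expr1n.
  by rewrite inner_tensorE; apply: eq_bigr => i _; rewrite expr2.
move=> /(_ p1).
have : \int[(P \x P)%E]_z ((\sum_i a i z.1 * a i z.2) * overlap_kernel Q K z.1 z.2) <= eps.
  apply: bm_le_Rintegral => //.
    apply: bmM => //; apply: bm_sum => i; apply: bmM.
      exact: (bm_comp measurable_fst (ba i)).
    exact: (bm_comp measurable_snd (ba i)).
  move=> -[x x']/=; have [x1|x1] := eqVneq (inner x x) 1; last first.
    by rewrite overlap_nonunit ?x1// mulr0.
  have [x'1|x'1] := eqVneq (inner x' x') 1; last first.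
    by rewrite overlap_nonunit ?x'1 ?orbT// mulr0.
  have -> : \sum_i a i x * a i x' = inner x x' ^+ d.
    rewrite -inner_tensor_pow inner_tensorE; apply: eq_bigr => i _.
    by rewrite /a x1 x'1 eqxx.
  by have [] := overlap_le x1 x'1.
move=> /(ler_wpM2l _) - /(_ (2 * s)^-1).
rewrite invr_ge0 mulr_ge0 ?(ltW s0)// => /(_ isT).
rewrite -/H /H/=; have := m_le1; lra.
Qed.

End finite_dimension.

(** * Overlap estimates *)

Section real_estimates.
Context {R : realType}.

(** Multiply 1 - y <= exp (- y) by exp y. *)
Lemma expR_le_1DyM (y : R) : expR y <= 1 + y * expR y.
Proof.
have := expR_ge1Dx (- y); rewrite -(ler_pM2r (expR_gt0 y)) -expRD addNr expR0.
lra.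
Qed.

Lemma cube_le_expR (x : R) : 0 <= x -> x ^+ 3 <= 27 * expR x.
Proof.
move=> x0; have -> : expR x = expR (x / 3) ^+ 3.
  by rewrite -expRM_natl; congr expR; field.
rewrite (_ : x ^+ 3 = 27 * (x / 3) ^+ 3); last by field.
rewrite ler_pM2l//; apply: lerXn2r; rewrite ?nnegrE ?expR_ge0 ?divr_ge0//.
by have := expR_ge1Dx (x / 3); lra.
Qed.

(** The summand with j the integer part of [Z] already suffices. This form turns an exponential
    moment into a sum of tail probabilities. *)
Lemma expR_le_staircase (k Z : R) (N : nat) : 0 <= k -> 0 <= Z <= N%:R ->
  expR (k * Z) <= \sum_(j < N.+1) expR (k * j.+1%:R) * (j%:R <= Z)%R%:R.
Proof.
move=> k0 /andP[Z0 ZN].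
have Zr : (Num.truncn Z < N.+1)%N.
  by rewrite ltnS -(ler_nat R); apply: le_trans ZN; rewrite truncn_le.
rewrite (bigD1 (Ordinal Zr))//= truncn_le Z0 mulr1.
apply: ler_wpDr; first by apply: sumr_ge0 => j _; rewrite mulr_ge0 ?expR_ge0.
by rewrite ler_expR ler_wpM2l// ltW// truncnS_gt.
Qed.

End real_estimates.

(** * A majorant of the second moment built from overlap tails *)

Section overlap.
Context {R : realType} (n : nat) (X : forall n, probability (n.-tuple R) R).
Hypotheses (n0 : (0 < n)%N) (X_sym : overlap_symmetric X).
Local Notation U := (n.-tuple R).
Local Notation P := (X n).
Local Notation tau z := `|inner z.1 z.2|.

Let measurable_tail (t : R) : measurable [set z : U * U | t <= tau z].
Proof.
have : measurable_fun [set: U * U] (fun z => t <= tau z).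
  apply: measurable_fun_ler => //; apply: measurableT_comp => //.
  exact: measurable_inner.
by move=> /(_ measurableT [set true]); rewrite setTI; apply.
Qed.

Let tailE (t : R) :
  (fun z : U * U => (t <= tau z)%R%:R : R) = \1_[set z : U * U | t <= tau z].
Proof.
apply/funext => z; rewrite indicE; congr ((nat_of_bool _)%:R).
by apply/idP/idP => [tz|/set_mem//]; rewrite mem_set.
Qed.

Lemma bm_abs_overlap (t : R) :
  bounded_measurable (fun z : U * U => (t <= tau z)%R%:R : R).
Proof. by rewrite tailE; exact: bm_indic. Qed.

(** By symmetry of the overlap, the two-sided tail is at most twice the one-sided one. *)
Lemma Rintegral_abs_overlap (t c : R) : (overlap_tail X n t <= c%:E)%E ->
  \int[(P \x P)%E]_z (t <= tau z)%R%:R <= 2 * c.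
Proof.
move=> tc; rewrite tailE -lee_fin Rintegral_indicE//.
have mI : measurable_fun setT (fun z : U * U => inner z.1 z.2) := @measurable_inner R n.
have mt : measurable [set r : R | t <= r].
  by rewrite (_ : mkset _ = `[t, +oo[%classic)//; apply/seteqP; split=> r /=; rewrite in_itv/= andbT.
have mA : measurable [set z : U * U | t <= inner z.1 z.2].
  by have := mI measurableT _ mt; rewrite setTI.
have mB : measurable [set z : U * U | t <= - inner z.1 z.2].
  by have := measurable_funN mI measurableT mt; rewrite setTI.
rewrite (_ : mkset _ = [set z : U * U | t <= inner z.1 z.2] `|`
    [set z : U * U | t <= - inner z.1 z.2]); last first.
  apply/seteqP; split=> z /=; rewrite real_ler_normr ?num_real//; first by move/orP.
  by move=> h; apply/orP.
apply: le_trans (measureU2 _ mA mB) _.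
have := X_sym n0 mt; rewrite /= => <-.
by rewrite mulrDl mul1r EFinD; apply: leeD.
Qed.

Context (d : nat) (lambda delta k C t1 gamma : R).
Hypotheses (X1 : on_unit_vectors X) (lambda_ge0 : 0 <= lambda) (delta_gt0 : 0 < delta).
Hypotheses (k0 : 0 < k) (t1_ge0 : 0 <= t1) (C0 : 0 <= C).

Local Notation V := (tensor R n d).
Local Notation v := (2 / n%:R : R).
Local Notation Q := (iid (gaussian 0 v) #|{: multi_index n d}|).
Local Notation K := (@truncated_likelihood R n d v lambda delta).
(** [kappa] is the exponential rate of the truncated second moment of two equal spikes. The summand
    1 in [Lam] ensures Lam >= 1, so that n Lam |r|^d also dominates |r|^d. *)
Local Notation kappa := (lambda ^+ 2 / 4 + lambda * delta / 2).
Local Notation Lam := (lambda ^+ 2 / 2 + 1).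

Hypothesis tail_subgaussian : forall t, 0 <= t <= 1 ->
  (overlap_tail X n t <= (C * expR (- (n%:R * (k * t ^+ 2))))%:E)%E.
Hypothesis tail_rate : (overlap_tail X n t1 <= (expR (- (n%:R * (kappa + gamma))))%:E)%E.
Hypotheses (d6 : (6 <= d)%N) (t1_small : Lam * t1 ^+ (d - 2) <= k / 2).

(** The first summand is a staircase above a multiple of exp (k Z), Z = n <x, x'>^2, with the steps
    Z >= j rewritten as overlap tails; the second covers overlaps of modulus at least [t1]. Both
    integrate directly against the tail bounds. *)
Definition overlap_majorant (z : U * U) : R :=
  Lam * 216 / k ^+ 3 / n%:R ^+ 2 *
    (\sum_(j < n.+1) expR (k * j.+1%:R) * (Num.sqrt (j%:R / n%:R) <= tau z)%R%:R)
  + expR (n%:R * kappa) * (t1 <= tau z)%R%:R.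

Let D_ge0 : 0 <= Lam * 216 / k ^+ 3 / n%:R ^+ 2.
Proof.
rewrite !mulr_ge0 ?invr_ge0 ?exprn_ge0 ?ler0n ?(ltW k0)//.
by rewrite addr_ge0 ?divr_ge0 ?exprn_ge0.
Qed.

Lemma bm_overlap_majorant : bounded_measurable overlap_majorant.
Proof.
apply: bmD; apply: bmZ; last exact: bm_abs_overlap.
by apply: bm_sum => j; apply: bmZ; exact: bm_abs_overlap.
Qed.

Let stair_ge0 (z : U * U) :
  0 <= \sum_(j < n.+1) expR (k * j.+1%:R) * (Num.sqrt (j%:R / n%:R) <= tau z)%R%:R.
Proof. by apply: sumr_ge0 => j _; rewrite mulr_ge0 ?expR_ge0. Qed.

Lemma overlap_majorant_ge0 z : 0 <= overlap_majorant z.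
Proof.
exact: (addr_ge0 (mulr_ge0 D_ge0 (stair_ge0 z)) (mulr_ge0 (expR_ge0 _) (ler0n _ _))).
Qed.

(** In each step of the staircase exp (k (j + 1)) meets a tail of order exp (- k j), so all n + 1
    steps contribute at most the same constant; in the last summand the tail beats exp (n kappa) by
    exp (- n gamma). *)
Lemma Rintegral_overlap_majorant :
  \int[(P \x P)%E]_z overlap_majorant z <=
  Lam * 216 / k ^+ 3 / n%:R ^+ 2 * (n.+1%:R * (2 * C * expR k))
  + 2 * expR (- (n%:R * gamma)).
Proof.
have bstair (j : 'I_n.+1) : bounded_measurable (fun z : U * U =>
    expR (k * j.+1%:R) * (Num.sqrt (j%:R / n%:R) <= tau z)%R%:R).
  by apply: bmZ; exact: bm_abs_overlap.
have btail := bm_abs_overlap t1.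
rewrite bm_RintegralD; [|by apply: bmZ; exact: bm_sum|exact: bmZ].
rewrite !bm_RintegralZ//; last exact: bm_sum.
apply: lerD; last first.
  apply: le_trans (ler_wpM2l (expR_ge0 _) (Rintegral_abs_overlap tail_rate)) _.
  by rewrite mulrCA -expRD ler_wpM2l// ler_expR; lra.
rewrite ler_wpM2l// bm_Rintegral_sum//.
rewrite (_ : n.+1%:R * _ = \sum_(j < n.+1) (2 * C * expR k)); last first.
  by rewrite sumr_const card_ord mulr_natl.
apply: ler_sum => j _; rewrite bm_RintegralZ; last exact: bm_abs_overlap.
have jn : 0 <= (j%:R / n%:R : R) <= 1.
  by rewrite divr_ge0//= ler_pdivrMr ?ltr0n// mul1r ler_nat -ltnS ltn_ord.
have /tail_subgaussian/Rintegral_abs_overlap H : 0 <= (Num.sqrt (j%:R / n%:R) : R) <= 1.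
  by rewrite sqrtr_ge0/= -[leRHS]sqrtr1 ler_wsqrtr//; case/andP: jn.
apply: le_trans (ler_wpM2l (expR_ge0 _) H) _.
rewrite sqr_sqrtr; last by case/andP: jn.
rewrite [n%:R * _](_ : _ = k * j%:R); last by field; rewrite pnatr_eq0 -lt0n.
rewrite [leLHS](_ : _ = 2 * C * (expR (k * j.+1%:R) * expR (- (k * j%:R)))); last by ring.
rewrite -expRD ler_wpM2l ?mulr_ge0// ler_expR -natr1; lra.
Qed.

(** For |r| >= t1, tilting by lambda / 2 gives exp (n kappa). For |r| < t1, tilting by lambda gives
    exp y with y = n Lam |r|^d, and y exp y bounds both the excess exp y - 1 and the weighted
    kernel. *)
Lemma overlap_kernel_le_majorant x x' : inner x x = 1 -> inner x' x' = 1 ->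
  overlap_kernel Q K x x' <= 1 + overlap_majorant (x, x') /\
  inner x x' ^+ d * overlap_kernel Q K x x' <= overlap_majorant (x, x').
Proof.
move=> x1 x'1; set r := inner x x'.
have v0 : 0 < v by rewrite divr_gt0// ltr0n.
have r1 : `|r| <= 1 by exact: inner_unit_le1.
have M0 : 0 <= overlap_kernel Q K x x'.
  by apply: Rintegral_ge0 => w _; rewrite mulr_ge0 ?truncated_likelihood_ge0.
have rd : r ^+ d <= `|r| ^+ d by rewrite -normrX ler_norm.
have rd1 : `|r| ^+ d <= 1 by rewrite exprn_ile1.
have nn0 : n%:R != 0 :> R by rewrite pnatr_eq0 -lt0n.
have np : 0 < n%:R :> R by rewrite ltr0n.
have Lam1 : 1 <= Lam by rewrite lerDr divr_ge0 ?exprn_ge0.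
have Lam0 : 0 < Lam := lt_le_trans ltr01 Lam1.
have [tr|tr] := lerP t1 `|r|.
  have MK : overlap_kernel Q K x x' <= overlap_majorant (x, x').
    have al : lambda / 2 <= lambda by rewrite ler_piMr// invf_le1 ?ler1n.
    apply: le_trans (overlap_truncated_likelihood_le d delta v0 lambda_ge0 x x' al) _.
    apply: ler_wpDl; first exact: mulr_ge0 D_ge0 (stair_ge0 (x, x')).
    rewrite /= -/r tr mulr1.
    rewrite ler_expR -/r invfM invrK.
    rewrite [leRHS](_ : _ = (2 * kappa) * (2^-1 * n%:R)); last by field.
    rewrite ler_pM2r ?mulr_gt0 ?invr_gt0//.
    have : lambda ^+ 2 * r ^+ d <= lambda ^+ 2 * 1.
      by rewrite ler_wpM2l ?exprn_ge0// (le_trans rd).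
    lra.
  split; first by rewrite (le_trans MK)// lerDr.
  apply: le_trans MK; rewrite ler_piMl//; exact: le_trans rd rd1.
pose y := n%:R * (Lam * `|r| ^+ d).
pose Z := n%:R * `|r| ^+ 2.
have y0 : 0 <= y.
  exact: mulr_ge0 (ltW np) (mulr_ge0 (ltW Lam0) (exprn_ge0 _ (normr_ge0 r))).
have Z0 : 0 <= Z := mulr_ge0 (ltW np) (exprn_ge0 _ (normr_ge0 r)).
have My : overlap_kernel Q K x x' <= expR y.
  apply: le_trans (overlap_truncated_likelihood_le d delta v0 lambda_ge0 x x' (lexx _)) _.
  rewrite ler_expR -/r invfM invrK /y.
  rewrite [leLHS](_ : _ = n%:R * (lambda ^+ 2 / 2 * r ^+ d)); last by field.
  rewrite (ler_wpM2l (ltW np))//.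
  rewrite mulrDl mul1r; apply: ler_wpDr; first by rewrite exprn_ge0.
  by rewrite ler_wpM2l ?divr_ge0 ?exprn_ge0.
(* Split off |r|^2 and bound the other d - 2 factors by [t1]: this keeps half of the subgaussian
   exponent available. *)
have yZ : y <= k / 2 * Z.
  rewrite /y /Z [leRHS]mulrCA (ler_wpM2l (ltW np))//.
  rewrite -(subnK (leq_trans (isT : 2 <= 6)%N d6)) exprD mulrA.
  rewrite ler_wpM2r ?exprn_ge0//; apply: le_trans t1_small.
  rewrite (ler_wpM2l (ltW Lam0))//.
  by apply: lerXn2r; rewrite ?nnegrE// ltW.
(* As d >= 6, |r|^d <= |r|^6; this is the source of the factor 1 / n^2, which outweighs the n + 1
   steps of the staircase. *)
have yZ3 : y <= Lam / n%:R ^+ 2 * Z ^+ 3.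
  rewrite /y /Z [leRHS](_ : _ = n%:R * (Lam * `|r| ^+ 6)); last by field.
  rewrite (ler_wpM2l (ltW np))// (ler_wpM2l (ltW Lam0))//.
  by rewrite ler_wiXn2l.
(* The cube is absorbed by the other half of the exponent, with 216 = 27 * 8 from the argument k Z /
   2. *)
have ZE : Z ^+ 3 <= 216 / k ^+ 3 * expR (k / 2 * Z).
  have kZ0 : 0 <= k / 2 * Z by rewrite mulr_ge0// divr_ge0// ltW.
  have := cube_le_expR kZ0.
  rewrite -(ler_pM2l (_ : 0 < 8 / k ^+ 3)); last by rewrite divr_gt0 ?exprn_gt0.
  rewrite [in X in X -> _](_ : _ * _ ^+ 3 = Z ^+ 3); last by field; rewrite gt_eqF.
  by rewrite mulrA (_ : 8 / k ^+ 3 * 27 = 216 / k ^+ 3)//; field; rewrite gt_eqF.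
have Zn : 0 <= Z <= n%:R.
  by rewrite Z0 /Z ler_piMr// exprn_ile1.
have stairE : \sum_(j < n.+1) expR (k * j.+1%:R) * (j%:R <= Z)%R%:R =
    \sum_(j < n.+1) expR (k * j.+1%:R) * (Num.sqrt (j%:R / n%:R) <= `|r|)%R%:R.
  apply: eq_bigr => j _; congr (_ * (nat_of_bool _)%:R).
  by rewrite -[in RHS]sqrtr_sqr ler_sqrt ?sqr_ge0// ler_pdivrMr// /Z real_normK ?num_real// mulrC.
have yM : y * expR y <= overlap_majorant (x, x').
  apply: ler_wpDr; first exact: mulr_ge0 (expR_ge0 _) (ler0n _ _).
  rewrite /= -/r -stairE.
  apply: (@le_trans _ _ (Lam * 216 / k ^+ 3 / n%:R ^+ 2 * expR (k * Z))); last first.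
    by rewrite ler_wpM2l//; apply: expR_le_staircase => //; exact: ltW.
  have e0 := expR_ge0 (k / 2 * Z).
  rewrite (_ : k * Z = k / 2 * Z + k / 2 * Z) ?expRD; last by field.
  apply: (@le_trans _ _ ((Lam / n%:R ^+ 2 * (216 / k ^+ 3 * expR (k / 2 * Z))) *
      expR (k / 2 * Z))).
    apply: ler_pM; rewrite ?expR_ge0 ?ler_expR//.
    apply: le_trans yZ3 _; rewrite ler_wpM2l//.
    by rewrite divr_ge0 ?exprn_ge0 ?(ltW Lam0).
  rewrite le_eqVlt; apply/orP; left; apply/eqP; field.
  by rewrite nn0 gt_eqF.
split; first by apply: le_trans My (le_trans (expR_le_1DyM y) _); rewrite lerD2l.
apply: le_trans yM.
apply: (@le_trans _ _ (`|r| ^+ d * overlap_kernel Q K x x')); first exact: ler_wpM2r.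
apply: ler_pM => //.
rewrite /y mulrA ler_peMl ?exprn_ge0//.
by rewrite -[leLHS]mulr1; apply: ler_pM; rewrite ?ler1n.
Qed.

End overlap.

(** * Asymptotics *)

Section asymptotics.
Context {R : realType} (X : forall n, probability (n.-tuple R) R).

Lemma expRN_le_inv (a : R) (n : nat) : (0 < n)%N -> 0 < a ->
  expR (- (n%:R * a)) <= a^-1 / n%:R.
Proof.
move=> n0 a0; have an0 : 0 < n%:R * a by rewrite mulr_gt0 ?ltr0n.
rewrite expRN -invfM [a * _]mulrC lef_pV2 ?posrE ?expR_gt0//.
by apply: le_trans (expR_ge1Dx _); rewrite lerDr.
Qed.

Lemma near_div_lt (c e : R) : 0 < e -> \forall n \near \oo, c / n%:R < e.
Proof.
move=> e0; near=> n.
have n0 : 0 < n%:R :> R by rewrite ltr0n; near: n; exact: nbhs_infty_gt.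
by rewrite ltr_pdivrMr// -ltr_pdivrMl// mulrC; near: n; exact: nbhs_infty_gtr.
Unshelve. all: by end_near. Qed.

Lemma measurable_overlap_tail (n : nat) (t : R) :
  measurable [set z : n.-tuple R * n.-tuple R | t <= inner z.1 z.2].
Proof.
have : measurable_fun [set: n.-tuple R * n.-tuple R] (fun z => t <= inner z.1 z.2).
  by apply: measurable_fun_ler => //; exact: measurable_inner.
by move=> /(_ measurableT [set true]); rewrite setTI; apply.
Qed.

Lemma finite_rate_tail (n : nat) (t c : R) : (0 < n)%N ->
  (c%:E <= finite_rate X n t)%E -> (overlap_tail X n t <= (expR (- (n%:R * c)))%:E)%E.
Proof.
move=> n0; rewrite /finite_rate.
have mt := @measurable_overlap_tail n t.
pose PP : probability (n.-tuple R * n.-tuple R)%type R := (X n \x X n)%E.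
have pfin : overlap_tail X n t \is a fin_num := fin_num_measure PP _ mt.
have : (0 <= overlap_tail X n t)%E := measure_ge0 PP _.
rewrite -(fineK pfin); set p := fine _.
(* A vanishing tail, where the rate is +oo, is treated apart: the bound is then trivial. *)
rewrite lee_fin le_eqVlt => /predU1P[<- _|p0]; first by rewrite lee_fin expR_ge0.
rewrite lne_EFin// -EFinM -EFinN !lee_fin => cp.
rewrite -{1}(lnK p0) ler_expR.
have n0' : 0 < n%:R :> R by rewrite ltr0n.
by rewrite -(ler_pM2l (_ : 0 < n%:R^-1 :> R)) ?invr_gt0// mulrN mulKf ?gt_eqF// lerNr.
Qed.

(** Take eta = 1. Beyond T = min (t0, 1) the tail is at most its value at T, and T^2 >= T^2 t^2 for
    t <= 1; so shrinking the constant by T^2 extends the local bound to all of [0, 1]. *)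
Lemma subgaussian_tail (sigma2 : R) : 0 < sigma2 -> locally_subgaussian X sigma2 ->
  exists k C, [/\ 0 < k, 0 <= C & forall n t, (0 < n)%N -> 0 <= t <= 1 ->
    (overlap_tail X n t <= (C * expR (- (n%:R * (k * t ^+ 2))))%:E)%E].
Proof.
move=> s0 /(_ 1 ltr01)[t0 [C [t00 C0 tail]]].
have q0 : 0 < 2 * sigma2 + 1 by rewrite addr_gt0// mulr_gt0.
pose T := Num.min t0 1.
have T0 : 0 < T by rewrite lt_min t00 ltr01.
have T1 : T <= 1 by rewrite ge_min lexx orbT.
have Tt : T <= t0 by rewrite ge_min lexx.
exists (T ^+ 2 / (2 * sigma2 + 1)), C.
split=> [||n t n0 /andP[t_ge0 t_le1]]; [by rewrite divr_gt0 ?exprn_gt0|exact: ltW|].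
have [tT|Tlt] := leP t T.
  apply: le_trans (tail n t n0 _) _; first by rewrite t_ge0 (le_trans tT).
  rewrite lee_fin (ler_wpM2l (ltW C0))// ler_expR lerN2 -[leRHS]mulrA ler_wpM2l ?ler0n//.
  rewrite mulrAC ler_wpM2r ?invr_ge0 ?(ltW q0)// ler_piMl ?sqr_ge0//.
  by rewrite exprn_ile1// ltW.
apply: (@le_trans _ _ (overlap_tail X n T)).
  apply: le_measure; rewrite ?inE; try exact: measurable_overlap_tail.
  by move=> z /= /(le_trans _); apply; exact: ltW.
apply: le_trans (tail n T n0 _) _; first by rewrite (ltW T0).
rewrite lee_fin (ler_wpM2l (ltW C0))// ler_expR lerN2 -[leRHS]mulrA ler_wpM2l ?ler0n//.
rewrite mulrAC ler_wpM2r ?invr_ge0 ?(ltW q0)// ler_piMr ?sqr_ge0//.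
by rewrite exprn_ile1.
Qed.

(** Since lambda^2 / 4 < F, a level r strictly between is exceeded by f at some t1 < 1, and the gap
    r - lambda^2 / 4 leaves room for both [delta] and [gamma]. *)
Lemma rate_gap (f : R -> R) (F : \bar R) (lambda : R) :
  (f t)%:E @[t --> 1^'-] --> F -> 0 <= lambda -> (lambda%:E < 2%:E * sqrte F)%E ->
  exists t1 delta gamma, [/\ 0 <= t1 < 1, 0 < delta, 0 < gamma &
    lambda ^+ 2 / 4 + lambda * delta / 2 + gamma < f t1].
Proof.
move=> fF l0 lF.
have [r lr rF] : exists2 r : R, lambda ^+ 2 / 4 < r & (r%:E < F)%E.
  case: F lF {fF} => [c| |] /=.
  - rewrite -EFinM lte_fin => lc.
    have c0 : 0 < c.
      rewrite -sqrtr_gt0; have : 0 < 2 * Num.sqrt c by exact: le_lt_trans l0 lc.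
      by rewrite pmulr_rgt0.
    have : lambda ^+ 2 < (2 * Num.sqrt c) ^+ 2.
      by rewrite ltr_pXn2r// nnegrE mulr_ge0// sqrtr_ge0.
    rewrite exprMn sqr_sqrtr ?ltW// => lc2.
    exists ((lambda ^+ 2 / 4 + c) / 2); rewrite ?lte_fin; lra.
  - by move=> _; exists (lambda ^+ 2 / 4 + 1); rewrite ?ltry// ltrDl.
  (* [sqrte] takes the value 0 at -oo, which contradicts lambda >= 0. *)
  - by rewrite mule0 lte_fin ltNge l0.
have : \forall t \near 1^'-, (r%:E < (f t)%:E)%E.
  apply: (fF [set y | (r%:E < y)%E]); apply: open_nbhs_nbhs; split => //.
  exact: open_ereal_gt_ereal.
move=> nf; have [t1 [[t1_gt0 t1_lt1] rft]] :
    exists t, (0 < t /\ t < 1) /\ (r%:E < (f t)%:E)%E.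
  apply: (@filter_ex _ (1^'-)); near=> t; split; [split|]; near: t => //.
  - exact: nbhs_left_gt.
  - exact: nbhs_left_lt.
pose g := r - lambda ^+ 2 / 4; have g0 : 0 < g by rewrite subr_gt0.
have l1 : 0 < lambda + 1 by rewrite ltr_wpDl.
(* Here lambda delta <= g, so the two corrections use at most g / 2 + g / 4 of the gap; the
   denominator lambda + 1 also covers lambda = 0. *)
exists t1, (g / (lambda + 1)), (g / 4); split; rewrite ?divr_gt0//; first by rewrite (ltW t1_gt0).
rewrite lte_fin in rft.
have : lambda * (g / (lambda + 1)) <= g.
  by rewrite mulrCA ler_piMr ?(ltW g0)// ler_pdivrMr// mul1r lerDl.
rewrite /g in g0 *; lra.
Unshelve. all: by end_near. Qed.

Lemma rate_tail (f : R -> R) (t1 c : R) : rate_function X f -> 0 <= t1 < 1 -> c < f t1 ->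
  \forall n \near \oo, (overlap_tail X n t1 <= (expR (- (n%:R * c)))%:E)%E.
Proof.
move=> [b [bX bf]] t1_01 cf.
have bt : b n t1 @[n --> \oo] --> f t1.
  have h : {uniform [set t1], b @ \oo --> f}.
    by apply: uniform_subset_cvg bf => x ->; rewrite /= in_itv/=.
  by rewrite uniform_set1 in h.
near=> n.
have n0 : (0 < n)%N by near: n; exact: nbhs_infty_gt.
apply: finite_rate_tail => //; apply: le_trans (bX n t1 n0 t1_01).
rewrite lee_fin ltW//; near: n.
exact: (cvgr_gt _ bt).
Unshelve. all: by end_near. Qed.

End asymptotics.

(** * Errors of order 1 / n for large d *)

Section asymptotic_bounds.
Context {R : realType} (X : forall n, probability (n.-tuple R) R).

Lemma overlap_error_le (D A gamma : R) (n : nat) : (0 < n)%N -> 0 <= D -> 0 <= A ->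
  0 < gamma ->
  D / n%:R ^+ 2 * (n.+1%:R * A) + 2 * expR (- (n%:R * gamma)) <=
  (2 * D * A + 2 / gamma) / n%:R.
Proof.
move=> n0 D0 A0 g0; rewrite [leRHS]mulrDl; apply: lerD; last first.
  by rewrite -mulrA ler_wpM2l// expRN_le_inv.
have np : 0 < n%:R :> R by rewrite ltr0n.
rewrite [leLHS](_ : _ = (D * A) * (n.+1%:R / n%:R ^+ 2)); last by field; rewrite gt_eqF.
rewrite [leRHS](_ : _ = (D * A) * (2 / n%:R)); last by field; rewrite gt_eqF.
rewrite (ler_wpM2l (mulr_ge0 D0 A0))// ler_pdivrMr ?exprn_gt0//.
rewrite expr2 mulrA divfK ?gt_eqF// -natr1.
have : 1 <= n%:R :> R by rewrite ler1n.
lra.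
Qed.

(** All of [t1], [delta], [gamma], [k], [C] are fixed before [d], so the threshold for [d] is
    independent of [n]. Since [B] does not depend on [s], one may fix [s] first and then let [n]
    grow. *)
Lemma detection_recovery_bounds (f : R -> R) (sigma2 : R) (F : \bar R) (lambda : R) :
  on_unit_vectors X -> overlap_symmetric X -> rate_function X f -> 0 < sigma2 ->
  locally_subgaussian X sigma2 -> (f t)%:E @[t --> 1^'-] --> F -> 0 <= lambda ->
  (lambda%:E < 2%:E * sqrte F)%E ->
  exists d0 : nat, forall d, (d0 <= d)%N -> exists B : R,
    \forall n \near \oo, [/\ (0 < n)%N,
      forall (A : set (tensor R n d)) s, measurable A -> 0 < s ->
        (spikedWT X n d lambda A <=
         WT n d A + (s / 2 + ((2 * s)^-1 + 1) * (B / n%:R))%:E)%E &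
      forall (xhat : {mfun tensor R n d >-> n.-tuple R}) s,
        (forall T, unit_vector (xhat T)) -> 0 < s ->
        ('E_(X n \x WT n d)[fun p => (inner p.1 (xhat (spike lambda p)) ^+ d)%R] <=
         (s / 2 + ((2 * s)^-1 + 1) * (B / n%:R))%:E)%E].
Proof.
move=> X1 X_sym X_rate s0 /(subgaussian_tail s0)[k [C [k0 C0 tail]]] fF l0 lF.
have [t1 [delta [gamma [t1_01 delta0 gamma0 gap]]]] := rate_gap fF l0 lF.
have ratet := rate_tail X_rate t1_01 gap.
have /andP[t1_ge0 t1_lt1] := t1_01.
pose Lam := lambda ^+ 2 / 2 + 1.
have Lam0 : 0 < Lam by rewrite ltr_wpDl// divr_ge0// exprn_ge0.
have [N HN] : exists N, forall m, (N <= m)%N -> Lam * t1 ^+ m <= k / 2.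
  have : \forall m \near \oo, t1 ^+ m < k / 2 / Lam.
    have t1n : `|t1| < 1 by rewrite ger0_norm.
    by apply: (cvgr_lt _ (cvg_expr t1n)); rewrite !divr_gt0.
  move=> [N _ HN]; exists N => m Nm; rewrite mulrC -ler_pdivlMr//.
  exact/ltW/HN.
(* 6 is for the cubic estimate, N + 2 for the d - 2 powers of [t1]. *)
exists (maxn 6 (N + 2)) => d; rewrite geq_max => /andP[d6 dN].
have t1_small : Lam * t1 ^+ (d - 2) <= k / 2.
  by apply: HN; have := leq_sub2r 2 dN; rewrite addnK.
(* [B0 / n] bounds the integral of the majorant and [B1 / n] the truncation loss. *)
pose B0 := 2 * (Lam * 216 / k ^+ 3) * (2 * C * expR k) + 2 / gamma.
pose B1 := (delta ^+ 2 / 4)^-1.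
exists (B0 + 2 * B1).
near=> n.
have n0 : (0 < n)%N by near: n; exact: nbhs_infty_gt.
have np : 0 < n%:R :> R by rewrite ltr0n.
have taun := fun t => tail n t n0.
have raten : (overlap_tail X n t1 <= (expR (- (n%:R *
  (lambda ^+ 2 / 4 + lambda * delta / 2 + gamma))))%:E)%E by near: n.
pose q := overlap_majorant lambda delta k t1 (n := n).
have bq : bounded_measurable q := bm_overlap_majorant n lambda delta k t1.
have q0 z : 0 <= q z := overlap_majorant_ge0 delta t1 l0 k0 z.
have qle := overlap_kernel_le_majorant n0 delta l0 k0 t1_ge0 d6 t1_small.
have qint : \int[(X n \x X n)%E]_z q z <= B0 / n%:R.
  apply: le_trans (Rintegral_overlap_majorant n0 X_sym l0 k0 C0 taun raten) _.
  apply: overlap_error_le n0 _ _ gamma0.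
  - exact: divr_ge0 (mulr_ge0 (ltW Lam0) (ler0n _ 216)) (exprn_ge0 _ (ltW k0)).
  - exact: mulr_ge0 (mulr_ge0 (ler0n _ 2) C0) (expR_ge0 k).
pose beta := expR (- delta ^+ 2 / (2 * (2 / n%:R))).
have betale : beta <= B1 / n%:R.
  rewrite /beta [X in expR X](_ : _ = - (n%:R * (delta ^+ 2 / 4))); last first.
    by field; rewrite gt_eqF.
  by apply: expRN_le_inv => //; rewrite divr_gt0 ?exprn_gt0.
have beta_ge0 : 0 <= beta := expR_ge0 _.
(* One expression dominates both errors: detection has 2 beta inside the bracket and one beta
   outside, recovery has 2 beta outside only. *)
have total (s : R) : 0 < s ->
    (2 * s)^-1 * (\int[(X n \x X n)%E]_z q z + 2 * beta) + 2 * beta <=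
    ((2 * s)^-1 + 1) * ((B0 + 2 * B1) / n%:R).
  move=> sp; rewrite [leRHS]mulrDl mul1r (mulrDl B0); apply: lerD.
    rewrite ler_wpM2l//; first by rewrite invr_ge0 mulr_ge0// ltW.
    by rewrite lerD// -mulrA ler_wpM2l.
  apply: ler_wpDl; last by rewrite -mulrA ler_wpM2l.
  by apply: le_trans qint; exact: Rintegral_ge0.
split=> // [A s mA sp|xhat s xhat1 sp].
  apply: le_trans (detection_bound n0 l0 delta0 X1 bq q0 qle mA sp) _.
  rewrite leeD2l// lee_fin; have := total s sp; rewrite -/beta; lra.
apply: le_trans (recovery_bound n0 l0 delta0 X1 bq q0 qle xhat1 sp) _.
rewrite lee_fin -/beta; apply: le_trans (lerD (lexx (s / 2)) (total s sp)).
rewrite addrA lerD2r lerD2l ler_wpM2l ?invr_ge0 ?mulr_ge0 ?(ltW sp)//.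
by rewrite lerDl mulr_ge0.
Unshelve. all: by end_near. Qed.

End asymptotic_bounds.

(** * Impossibility of weak detection and weak recovery *)

Theorem proposition4p3 (R : realType)
  (X : forall n : nat, probability (n.-tuple R) R)
  (f : R -> R) (sigma2 : R) (F : \bar R) (lambda : R)
  (X_unit : on_unit_vectors X)
  (X_sym : overlap_symmetric X)
  (X_rate : rate_function X f)
  (sigma2_gt0 : 0 < sigma2)
  (X_subgaussian : locally_subgaussian X sigma2)
  (f_lim : (f t)%:E @[t --> 1^'-] --> F)
  (lambda_ge0 : 0 <= lambda)
  (lambda_lt : (lambda%:E < 2%:E * sqrte F)%E) :
  exists d0 : nat, forall d : nat, (2 <= d)%N -> (d0 <= d)%N ->
    ~ weak_detection X d lambda /\ ~ weak_recovery X d lambda.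
Proof.
have [d0 H] := detection_recovery_bounds X_unit X_sym X_rate sigma2_gt0
  X_subgaussian f_lim lambda_ge0 lambda_lt.
exists d0 => d _ /H[B HB].
(* With s = eps the total error is below eps / 2 + eps / 2 = eps for large [n], so one such [n]
   contradicts an advantage of eps. *)
have small (eps : R) : 0 < eps ->
    \forall n \near \oo, ((2 * eps)^-1 + 1) * (B / n%:R) < eps / 2.
  by move=> e0; under eq_near do rewrite mulrA; apply: near_div_lt; rewrite divr_gt0.
split.
- move=> [eps [phi [e0 success]]].
  have [n [[n0 det _] [sn en]]] := filter_ex (filterI HB (filterI success (small _ e0))).
  pose A := [set T | phi n T = true].
  have mA : measurable A.
    have := @measurable_funPT _ _ _ _ (phi n) measurableT [set true].
    by rewrite setTI; apply.
  have := det A eps mA e0.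
  have -> : WT n d A = (fine (WT n d A))%:E by rewrite fineK// fin_num_measure.
  move: sn; rewrite /success_probability -/A.
  (* Passing to the complement, the success probability is 1/2 plus half the difference of the two
     laws on [A], hence below 1/2 + eps / 2. *)
  have -> : WT n d [set T | phi n T = false] = (1 - fine (WT n d A))%:E.
    rewrite EFinB fineK ?fin_num_measure// -probability_setC//; congr (WT n d _).
    by apply/seteqP; split=> T; rewrite /A /=; case: (phi n T) => // /(_ erefl).
  rewrite -(@fineK _ (spikedWT X n d lambda A)) ?fin_num_measure//.
  rewrite -!EFinM -!EFinD !lee_fin.
  lra.
- move=> [eps [xhat [e0 xhat1 success]]].
  have [n [[n0 _ rec] [sn en]]] := filter_ex (filterI HB (filterI success (small _ e0))).
  have := le_trans sn (rec (xhat n) eps (fun T => xhat1 n T n0) e0).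
  rewrite lee_fin; lra.
Qed.
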